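(* Let $\Phi$ be an analytic surface in $\mathbb{R}^3$. Assume that through each point of $\Phi$ one can draw two transversal arcs of isotropic circles fully contained in the surface (and analytically depending on the point). Assume that these two arcs lie neither in the same isotropic sphere nor in the same plane. Assume that through each point in some dense subset of the surface one can draw only finitely many (not nested) arcs of isotropic circles and line segments contained in the surface. Let $$\Phi(u,v)=\left(\frac{P_0P_1-P_2P_3}{P_0^2+P_3^2},\frac{P_1P_3+P_0P_2}{P_0^2+P_3^2},\frac{Z}{P_0^2+P_3^2}\right),\qquad P_0,P_1,P_2,P_3\in\mathbb{R}_{1,1},\ Z\in\mathbb{R}_{2,2},\ P_0^2+P_3^2\ne0,$$ be a parametrization of the surface (possibly besides a one-dimensional subset) such that the arcs of the isotropic circles are the curves $u=\mathrm{const}$ and $v=\mathrm{const}$. If the top views of the isotropic circles $u=\mathrm{const}$ are all tangent to some regular smooth curve, then this curve is contained in a cyclic. In this case, if the top views of the isotropic circles $v=\mathrm{const}$ are all tangent to some regular smooth curve as well, then this curve is contained in the same cyclic.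
   Context: $\mathbb{R}^3$ carries Cartesian coordinates $(x,y,z)$; a line is vertical if it is parallel to the axis $Oz$. An isotropic circle in $\mathbb{R}^3$ is either a parabola with vertical axis or an ellipse whose orthogonal projection to the plane $Oxy$ is a circle. The orthogonal projection of an isotropic circle to the plane $Oxy$ is called its top view (a line or a circle). An isotropic sphere in $\mathbb{R}^3$ is either a paraboloid of revolution with vertical axis or a circular cylinder with vertical axis. An analytic surface in $\mathbb{R}^3$ is the image of an injective real analytic map of a planar domain into $\mathbb{R}^3$ with nondegenerate differential at each point. An isotropic circular arc analytically depending on a point of an analytic surface is a real analytic map of the surface into the real analytic variety of all isotropic circular arcs in $\mathbb{R}^3$. $\mathbb{R}_{i,j}$ denotes the set of all polynomials $F\in\mathbb{R}[u,v]$ with $\deg_u F\le i$ and $\deg_v F\le j$. (A parametrization of the stated form always exists under the stated assumptions on the surface.) A cyclic is a subset of the plane given by an equation $$a(x^2+y^2)^2+(x^2+y^2)(bx+cy)+Q(x,y)=0,$$ where $a,b,c\in\mathbb{R}$ and $Q\in\mathbb{R}[x,y]$ has degree at most $2$ (and $a,b,c,Q$ do not vanish simultaneously). The phrase ''a one-parameter family of lines or circles is tangent to a curve'' is understood in the sense that the curve is an envelope of the family: every member of the family is tangent to the curve, and at each of its points the curve is tangent to a member of the family. *)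

(* Defs.v *)
(* The plane is R * R and the space is R * R * R, for an arbitrary            *)
(* R : realType; the orthogonal projection to the plane Oxy is fst.           *)
From HB Require Import structures.
From mathcomp Require Import all_boot all_order all_algebra polyXY.
From mathcomp Require Import all_classical all_reals all_analysis.

Set Implicit Arguments.
Unset Strict Implicit.
Unset Printing Implicit Defensive.

Import Order.TTheory GRing.Theory Num.Theory.
Import numFieldNormedType.Exports.

Local Open Scope classical_set_scope.
Local Open Scope ring_scope.

Section Planar.
Variable R : realType.
Local Notation plane := (R * R)%type.

Definition plane_circle (T : set plane) : Prop :=
  exists c : plane, exists2 r : R, 0 < r &
    T = [set w | (w.1 - c.1) ^+ 2 + (w.2 - c.2) ^+ 2 = r ^+ 2].

(* For a bivariate polynomial F : {poly {poly R}}, F.[x, y] evaluates the     *)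
(* outer variable at x and the inner one at y; hence size F bounds the degree *)
(* in the first variable, sizeY F the degree in the second one, and F`_i`_j   *)
(* is the coefficient of x ^ i * y ^ j.                                       *)
Definition bidegree_le (i j : nat) (F : {poly {poly R}}) : Prop :=
  (size F <= i.+1)%N /\ (sizeY F <= j.+1)%N.

Definition total_degree_le (d : nat) (F : {poly {poly R}}) : Prop :=
  forall i j : nat, (d < i + j)%N -> F`_i`_j = 0.

Definition cyclic_curve (K : set plane) : Prop :=
  exists a b c : R, exists Q : {poly {poly R}},
    [/\ total_degree_le 2 Q,
        ~ [/\ a = 0, b = 0, c = 0 & Q = 0] &
        K = [set w | a * (w.1 ^+ 2 + w.2 ^+ 2) ^+ 2
                     + (w.1 ^+ 2 + w.2 ^+ 2) * (b * w.1 + c * w.2)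
                     + Q.[w.1, w.2] = 0]].

(* A parametrized C^oo immersion of an open interval. *)
Definition regular_smooth_curve (I : set R) (g : R -> plane) : Prop :=
  [/\ open I, is_interval I, I !=set0,
      forall (n : nat) (t : R), I t -> derivable (derive1n n g) t 1 &
      forall t : R, I t -> derive1 g t != 0].

End Planar.

Section TangentVectors.
Variables (R : realType) (V : normedModType R).

(* For a smooth submanifold S and p in S these are the elements of the        *)
(* tangent space of S at p.                                                   *)
Definition tangent_vector (S : set V) (p h : V) : Prop :=
  exists g : R -> V,
    [/\ g 0 = p, forall t, S (g t) & is_derive (0 : R) (1 : R) g h].

End TangentVectors.

Section Envelope.
Variable R : realType.
Local Notation plane := (R * R)%type.

Definition tangent_to_curve (T : set plane) (g : R -> plane) (t : R) : Prop :=
  T (g t) /\ tangent_vector T (g t) (derive1 g t).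

Definition envelope (fam : set (set plane)) (I : set R) (g : R -> plane) :
  Prop :=
  (forall T, fam T -> exists2 t, I t & tangent_to_curve T g t) /\
  (forall t, I t -> exists2 T, fam T & tangent_to_curve T g t).

End Envelope.

Section Analyticity.
Variable R : realType.
Local Notation plane := (R * R)%type.
Local Notation space := (R * R * R)%type.

(* Absolute convergence, to s, of the double series of a i j. *)
Definition double_series_to (a : nat -> nat -> R) (s : R) : Prop :=
  (exists M : R, forall n : nat, \sum_(i < n) \sum_(j < n) `|a i j| <= M) /\
  (fun n : nat => \sum_(i < n) \sum_(j < n) a i j : R) @ \oo --> s.

Definition analytic_on (D : set plane) (h : plane -> R) : Prop :=
  forall w0, D w0 -> exists c : nat -> nat -> R, exists2 r : R, 0 < r &
    forall w : plane, `|w.1 - w0.1| < r -> `|w.2 - w0.2| < r ->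
      double_series_to
        (fun i j => c i j * (w.1 - w0.1) ^+ i * (w.2 - w0.2) ^+ j) (h w).

Definition analytic_map_on (D : set plane) (h : plane -> space) : Prop :=
  [/\ analytic_on D (fun w => (h w).1.1),
      analytic_on D (fun w => (h w).1.2) &
      analytic_on D (fun w => (h w).2)].

(* The surface itself is the image f @` D. *)
Definition analytic_surface (D : set plane) (f : plane -> space) : Prop :=
  [/\ [/\ open D, connected D & D !=set0],
      analytic_map_on D f,
      {in D &, injective f} &
      forall w, D w -> forall h : plane, 'd f w h = 0 -> h = 0].

End Analyticity.

Section Isotropic.
Variable R : realType.
Local Notation plane := (R * R)%type.
Local Notation space := (R * R * R)%type.

Definition space_line (L : set space) : Prop :=
  exists p : space, exists2 d : space, d != 0 &
    L = [set p + t *: d | t in [set: R]].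

Definition space_plane (S : set space) : Prop :=
  exists a b c d : R, ~ [/\ a = 0, b = 0 & c = 0] /\
    S = [set p | a * p.1.1 + b * p.1.2 + c * p.2 + d = 0].

(* Vertex o, axis through o parallel to Oz, horizontal direction d. *)
Definition vertical_parabola (C : set space) : Prop :=
  exists (o : space) (d : plane) (k : R), [/\ d != 0, k != 0 &
    C = [set o + ((t *: d, k * t ^+ 2) : space) | t in [set: R]]].

Definition dot (a b : space) : R :=
  a.1.1 * b.1.1 + a.1.2 * b.1.2 + a.2 * b.2.

(* Center o, semi-axes a and b; circles are ellipses. *)
Definition ellipse (C : set space) : Prop :=
  exists o a b : space, [/\ a != 0, b != 0, dot a b = 0 &
    C = [set o + (cos t *: a + sin t *: b) | t in [set: R]]].

Definition isotropic_circle (C : set space) : Prop :=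
  vertical_parabola C \/ (ellipse C /\ plane_circle (fst @` C)).

Definition top_view (C : set space) : set plane := fst @` C.

Definition paraboloid_of_revolution (S : set space) : Prop :=
  exists (o : space) (k : R), k != 0 /\
    S = [set p | p.2 - o.2 =
                 k * ((p.1.1 - o.1.1) ^+ 2 + (p.1.2 - o.1.2) ^+ 2)].

Definition vertical_cylinder (S : set space) : Prop :=
  exists2 T : set plane, plane_circle T & S = [set p | T p.1].

Definition isotropic_sphere (S : set space) : Prop :=
  paraboloid_of_revolution S \/ vertical_cylinder S.

(* A closed arc of an isotropic circle, with endpoints p and q and with an    *)
(* interior point m.                                                          *)
Definition isotropic_arc (A : set space) (p m q : space) : Prop :=
  (exists2 C, isotropic_circle C & A `<=` C) /\
  exists g : R -> space,
    [/\ {within `[0, 1], continuous g},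
        {in `[0, 1] &, injective g},
        g @` `[0, 1] = A,
        g 0 = p /\ g 1 = q &
        exists2 t : R, 0 < t < 1 & g t = m].

(* Arcs of isotropic circles are determined by their endpoints and an         *)
(* interior point: if the top views of these three points are not collinear   *)
(* the carrier is an ellipse, otherwise it is a parabola.  Such triples       *)
(* (normalized by requiring the top view of m to be equidistant from those of *)
(* p and q) are local coordinates on the variety of arcs, so a map to this    *)
(* variety is analytic iff it is locally given by analytic p, m, q.           *)
(* Here A maps each point of the surface f @` D to an arc.                    *)
Definition analytic_arcs (D : set plane) (f : plane -> space)
    (A : space -> set space) : Prop :=
  forall w0, D w0 -> exists W : set plane,
    [/\ open W, W w0, W `<=` D &
    exists p m q : plane -> space,
      [/\ analytic_map_on W p, analytic_map_on W m, analytic_map_on W q &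
          forall w, W w -> isotropic_arc (A (f w)) (p w) (m w) (q w)]].

(* The tangents at p of the isotropic circles carrying A and B are distinct;  *)
(* the circles are used since p may be an endpoint of an arc.                 *)
Definition transversal_at (A B : set space) (p : space) : Prop :=
  forall CA CB, isotropic_circle CA -> A `<=` CA ->
    isotropic_circle CB -> B `<=` CB ->
    forall h, tangent_vector CA p h -> tangent_vector CB p h -> h = 0.

(* An arc of an isotropic circle or a line segment through p contained in X,  *)
(* not necessarily closed.                                                    *)
Definition arc_or_segment_in (X : set space) (p : space) (A : set space) :
  Prop :=
  [/\ A `<=` X, A p, connected A, exists2 q, A q & q <> p &
      exists2 C, isotropic_circle C \/ space_line C & A `<=` C].

(* Not nested in a larger arc or segment in X.  With closed arcs only, an     *)
(* open surface could have no maximal arc at all.                             *)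
Definition maximal_arc_in (X : set space) (p : space) (A : set space) : Prop :=
  arc_or_segment_in X p A /\
  forall B, arc_or_segment_in X p B -> A `<=` B -> B = A.

Section Parametrization.
Variables P0 P1 P2 P3 Z : {poly {poly R}}.

Definition denominator (w : plane) : R :=
  P0.[w.1, w.2] ^+ 2 + P3.[w.1, w.2] ^+ 2.

Definition parametrization (w : plane) : space :=
  let p0 := P0.[w.1, w.2] in let p1 := P1.[w.1, w.2] in
  let p2 := P2.[w.1, w.2] in let p3 := P3.[w.1, w.2] in
  ((p0 * p1 - p2 * p3) / denominator w,
   (p1 * p3 + p0 * p2) / denominator w,
   Z.[w.1, w.2] / denominator w).

(* The closure adds the point corresponding to an infinite value of the       *)
(* other parameter.                                                           *)
Definition u_circle (u : R) : set space :=
  closure [set parametrization (u, v) | v in [set v | denominator (u, v) != 0]].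
Definition v_circle (v : R) : set space :=
  closure [set parametrization (u, v) | u in [set u | denominator (u, v) != 0]].

(* The parameters run over Omega.  A subset of a surface has dimension at     *)
(* most 1 iff it has no interior point in the surface: the third clause says  *)
(* that the part of the surface f @` D not covered is such.                   *)
Definition parametrizes (Omega D : set plane) (f : plane -> space)
    (alpha beta : space -> set space) : Prop :=
  [/\ open Omega /\ (forall w, Omega w -> denominator w != 0),
      parametrization @` Omega `<=` f @` D,
      interior (D `&` [set w | ~ (parametrization @` Omega) (f w)]) = set0,
      forall w, Omega w -> isotropic_circle (u_circle w.1) /\
                           alpha (parametrization w) `<=` u_circle w.1 &
      forall w, Omega w -> isotropic_circle (v_circle w.2) /\
                           beta (parametrization w) `<=` v_circle w.2].

Definition u_top_views (Omega : set plane) : set (set plane) :=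
  [set top_view (u_circle w.1) | w in Omega].
Definition v_top_views (Omega : set plane) : set (set plane) :=
  [set top_view (v_circle w.2) | w in Omega].

End Parametrization.
End Isotropic.

(* Main.v *)
Require Import Defs.
From mathcomp Require Import all_boot all_order all_algebra polyXY ring lra.
From mathcomp Require Import all_classical all_reals all_analysis.

Set Implicit Arguments.
Unset Strict Implicit.
Unset Printing Implicit Defensive.

Import Order.TTheory GRing.Theory Num.Theory.
Import numFieldNormedType.Exports.
Local Open Scope classical_set_scope.
Local Open Scope ring_scope.

(** Identify the plane with the complex numbers. The top view of the
    parametrization is (P1 + i P2) / (P0 - i P3), so a point w is the image of
    (u, v) iff (P0 - i P3) w = P1 + i P2, which is a pair of real equations that
    are linear in u and in v. Eliminating v gives the equation of the top view
    of the isotropic circle u = const: q0 + u q1 + u^2 q2 = 0, where the q_i are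
    circle forms a (x^2 + y^2) + b x + c y + d in w. An envelope is expected on
    the discriminant q1^2 - 4 q0 q2 = 0. This is the equation of a cyclic,
    provided that it is not identically zero ([discriminant_eq0]: otherwise the
    two isotropic circles through a point would lie over the same circle or
    line). It is also the hyperdeterminant of the array of coefficients of the
    two bilinear equations, hence the same for the circles v = const
    ([u_discriminant_swapXY]).

    An envelope need not lie on the discriminant, however, because the
    parameter of the circle touching it need not vary: if all circles of the
    family touch each other at one point, then a piece of any one of them
    around this point is an envelope. This is the only exception. Off the
    discriminant the parameter of the tangent circle is a root of a quadratic
    equation with two smooth branches, and tangency means that it is
    stationary; so on a dense set of points the curve runs locally along single
    circles of the family ([constant_parameter]). As the derivative of its
    curvature is continuous, the curve cannot pass from one circle to another.
    Where it meets the discriminant it has contact of infinite order with its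
    circle s, along which the discriminant is the square of a circle form that
    is not a multiple of s, and thus vanishes to finite order; so the curve
    cannot leave s there either ([arc_extends]). The result is an alternative
    ([discriminant_or_member]): an envelope runs on the discriminant or on one
    circle s of the family.

    In the second case all circles of the family touch s, and a pencil argument
    shows that they do so at one point P ([discriminant_pencil]). Then the
    discriminant is a quadratic form in the equation of s and the squared
    distance to P, so that it vanishes on two circles or lines at most; and by
    the argument on curvature a regular smooth curve on which it vanishes lies
    on one of them ([binary_form_one_circle]). So, for the two families together
    ([envelope_cases]), either both envelopes lie on the discriminant, or each
    lies on a circle or line, and the union of two of these is a cyclic. *)

(** * Derivatives on an interval *)

Section RealCalculus.
Variable R : realType.
Implicit Types (f g : R -> R) (A : set R).

Lemma is_derive_add f g (t a b : R) : is_derive t (1 : R) f a ->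
  is_derive t (1 : R) g b -> is_derive t (1 : R) (fun s => f s + g s) (a + b).
Proof. by move=> hf hg; exact: is_deriveD. Qed.

Lemma is_derive_mul f g (t a b : R) : is_derive t (1 : R) f a ->
  is_derive t (1 : R) g b ->
  is_derive t (1 : R) (fun s => f s * g s) (a * g t + f t * b).
Proof.
move=> hf hg; have /is_derive_eq := is_deriveM hf hg; apply.
by rewrite addrC mulrC.
Qed.

Lemma is_derive_mulc (c : R) f (t a : R) : is_derive t (1 : R) f a ->
  is_derive t (1 : R) (fun s => c * f s) (c * a).
Proof. by move=> hf; exact: is_deriveZ. Qed.

Lemma is_derive_div f g (t a b : R) : g t != 0 -> is_derive t (1 : R) f a ->
  is_derive t (1 : R) g b ->
  is_derive t (1 : R) (fun s => f s / g s) ((a * g t - f t * b) / g t ^+ 2).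
Proof.
move=> gt0 hf hg; have := is_derive_mul hf (is_deriveV gt0 hg).
move/is_derive_eq; apply; rewrite -[_ *: _]/(_ * _).
by field.
Qed.

Lemma is_derive_continuous f (t a : R) :
  is_derive t (1 : R) f a -> {for t, continuous f}.
Proof. by case=> df _; apply/differentiable_continuous/derivable1_diffP. Qed.

Lemma is_derive_unique f (t a b : R) : is_derive t (1 : R) f a ->
  is_derive t (1 : R) f b -> a = b.
Proof. by move=> [_ <-] [_ <-]. Qed.

Lemma is_interval_ball (b e : R) : is_interval (ball b e).
Proof.
move=> s t; rewrite /ball /= => hs ht r /andP[h1 h2].
by move: hs ht; rewrite !ltr_norml => /andP[? ?] /andP[? ?]; apply/andP; lra.
Qed.

Lemma mean_value A f (df : R -> R) : is_interval A ->
  (forall t, A t -> is_derive t (1 : R) f (df t)) ->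
  forall s t, A s -> A t -> exists2 c, A c /\ `|c - s| <= `|t - s| &
    f t - f s = df c * (t - s).
Proof.
move=> itvA hf s t As At; have [st|ts] := leP s t.
- have hc c : c \in `[s, t] -> A c.
    by rewrite in_itv /= => hc; exact: itvA As At _ hc.
  have [||c hcst e] := @MVT_segment _ f df s t st.
  + by move=> c hc1; apply/hf/hc; exact: subset_itv_oo_cc.
  + by apply: derivable_within_continuous => c /hc /hf[].
  exists c => //; split; first exact: hc.
  move: hcst; rewrite in_itv /= => /andP[h1 h2].
  by rewrite !ger0_norm ?subr_ge0 //; lra.
- have hc c : c \in `[t, s] -> A c.
    by rewrite in_itv /= => hc; exact: itvA At As _ hc.
  have [||c hcst e] := @MVT_segment _ f df t s (ltW ts).
  + by move=> c hc1; apply/hf/hc; exact: subset_itv_oo_cc.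
  + by apply: derivable_within_continuous => c /hc /hf[].
  exists c; last by rewrite -opprB e; ring.
  split; first exact: hc.
  move: hcst; rewrite in_itv /= => /andP[h1 h2].
  by rewrite !ler0_norm ?subr_le0 ?(ltW ts) //; lra.
Qed.

Lemma derive0_cst A f : is_interval A ->
  (forall t, A t -> is_derive t (1 : R) f 0) ->
  forall s t, A s -> A t -> f s = f t.
Proof.
move=> itvA hf s t As At.
have [c _ /eqP] := mean_value itvA hf As At.
by rewrite mul0r subr_eq0 => /eqP.
Qed.

(** If the derivatives of orders at most m of f vanish at b, then f is
    o((t - b)^m); the mean value theorem gives the induction step. *)
Lemma flat_little_o (F : nat -> R -> R) (b : R) (m : nat) :
  (forall k, \forall t \near b, is_derive t (1 : R) (F k) (F k.+1 t)) ->
  (forall k, (k <= m)%N -> F k b = 0) ->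
  forall e, 0 < e -> \forall t \near b, `|F 0 t| <= e * `|t - b| ^+ m.
Proof.
elim: m F => [|m IH] F dF F0 e e0.
  have /is_derive_continuous cF := nbhs_singleton (dF 0%N).
  have /cvgrPdist_le /(_ _ e0) : F 0%N t @[t --> b] --> (0 : R).
    by rewrite -(F0 0%N (leqnn _)).
  by apply: filterS => t; rewrite sub0r normrN expr0 mulr1.
have /(_ e e0) h1 := IH (fun k => F k.+1) (fun k => dF k.+1) (fun k hk => F0 k.+1 hk).
have [r /= r0 hr] := (nbhs_ballP _ _).1 (filterI h1 (dF 0%N)).
apply/nbhs_ballP; exists r => //= t bt.
have [c [cb cle]] := mean_value (@is_interval_ball b r)
  (fun s hs => (hr s hs).2) (ballxx b r0) bt.
rewrite F0 // subr0 => ->; rewrite normrM exprSr mulrA ler_wpM2r //.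
apply: le_trans (hr c cb).1 _.
by rewrite ler_wpM2l ?(ltW e0) // lerXn2r // nnegrE.
Qed.

End RealCalculus.

(** * Circle forms and their contact with a curve *)

Section CircleForms.
Variable R : realType.
Local Notation plane := (R * R)%type.

(** (a, b, c, d) stands for a (x^2 + y^2) + b x + c y + d: the zero sets of
    these forms are the circles and lines, and some degenerate sets. *)
Definition circle_form : Type := (R * R * R * R)%type.

Implicit Type h : circle_form.

Definition cf_eval h (w : plane) : R :=
  h.1.1.1 * (w.1 ^+ 2 + w.2 ^+ 2) + h.1.1.2 * w.1 + h.1.2 * w.2 + h.2.

Definition cf_lin (k : R) h (l : R) h' : circle_form :=
  (k * h.1.1.1 + l * h'.1.1.1, k * h.1.1.2 + l * h'.1.1.2,
   k * h.1.2 + l * h'.1.2, k * h.2 + l * h'.2).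

Definition cf_scale (k : R) h : circle_form :=
  (k * h.1.1.1, k * h.1.1.2, k * h.1.2, k * h.2).

Definition cf0 : circle_form := (0, 0, 0, 0).

(** The squared distance to P: the circle of radius 0 around P. *)
Definition cf_point (P : plane) : circle_form :=
  (1, - 2 * P.1, - 2 * P.2, P.1 ^+ 2 + P.2 ^+ 2).

Lemma cf_eval_lin k h l h' w :
  cf_eval (cf_lin k h l h') w = k * cf_eval h w + l * cf_eval h' w.
Proof. by rewrite /cf_eval /=; ring. Qed.

Lemma cf_eval_scale k h w : cf_eval (cf_scale k h) w = k * cf_eval h w.
Proof. by rewrite /cf_eval /=; ring. Qed.

Lemma cf_eval_point P w :
  cf_eval (cf_point P) w = (w.1 - P.1) ^+ 2 + (w.2 - P.2) ^+ 2.
Proof. by rewrite /cf_eval /=; ring. Qed.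

Lemma cf_scale0 h : cf_scale 0 h = cf0.
Proof. by rewrite /cf_scale !mul0r. Qed.

Lemma cf_ext h h' : h.1.1.1 = h'.1.1.1 -> h.1.1.2 = h'.1.1.2 ->
  h.1.2 = h'.1.2 -> h.2 = h'.2 -> h = h'.
Proof. by case: h h' => [[[? ?] ?] ?] [[[? ?] ?] ?] /= -> -> -> ->. Qed.

Lemma sum_sqr_eq0 (a b : R) : a ^+ 2 + b ^+ 2 = 0 -> a = 0 /\ b = 0.
Proof.
move=> /eqP; rewrite paddr_eq0 ?sqr_ge0 // !sqrf_eq0 => /andP[/eqP ? /eqP ?].
by [].
Qed.

End CircleForms.

Section Jets.
Variables (R : realType) (x y : nat -> R -> R).
Implicit Type h : circle_form R.

(** Here z k stands for the k-th derivative of a function, so that this is the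
    k-th derivative of z i * z j, by the Leibniz rule without binomials. *)
Fixpoint product_jet (z : nat -> R -> R) (k i j : nat) (t : R) : R :=
  if k is k'.+1 then product_jet z k' i.+1 j t + product_jet z k' i j.+1 t
  else z i t * z j t.

(** The k-th derivative of h along the curve with coordinates x 0 and y 0. *)
Definition jet h (k : nat) (t : R) : R :=
  h.1.1.1 * (product_jet x k 0 0 t + product_jet y k 0 0 t)
  + h.1.1.2 * x k t + h.1.2 * y k t + (if k is 0%N then h.2 else 0).

Lemma jet0E h t : jet h 0 t = cf_eval h (x 0%N t, y 0%N t).
Proof. by rewrite /jet /cf_eval /= !expr2. Qed.

Lemma jet_lin k h l h' n t :
  jet (cf_lin k h l h') n t = k * jet h n t + l * jet h' n t.
Proof. by rewrite /jet /=; case: n => [|n]; ring. Qed.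

Lemma jet_scale k h n t : jet (cf_scale k h) n t = k * jet h n t.
Proof. by rewrite /jet /=; case: n => [|n]; ring. Qed.

Variable I : set R.
Hypothesis dx : forall k t, I t -> is_derive t (1 : R) (x k) (x k.+1 t).
Hypothesis dy : forall k t, I t -> is_derive t (1 : R) (y k) (y k.+1 t).

Lemma is_derive_product_jet z :
  (forall k t, I t -> is_derive t (1 : R) (z k) (z k.+1 t)) ->
  forall k i j t, I t ->
  is_derive t (1 : R) (product_jet z k i j) (product_jet z k.+1 i j t).
Proof.
move=> dz; elim=> [|k IH] i j t It /=; last exact: is_derive_add (IH _ _ _ It) (IH _ _ _ It).
exact: is_derive_mul (dz i t It) (dz j t It).
Qed.

Lemma is_derive_jet h k t : I t -> is_derive t (1 : R) (jet h k) (jet h k.+1 t).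
Proof.
move=> It; have hx := is_derive_product_jet dx k 0 0 It.
have hy := is_derive_product_jet dy k 0 0 It.
have hp := is_derive_mulc h.1.1.1 (is_derive_add hx hy).
have hl := is_derive_add (is_derive_mulc h.1.1.2 (dx k It)) (is_derive_mulc h.1.2 (dy k It)).
have := is_derive_add (is_derive_add hp hl) (is_derive_cst (if k is 0%N then h.2 else 0) t 1).
rewrite addr0 => hj; have <- : (fun s => h.1.1.1 * (product_jet x k 0 0 s + product_jet y k 0 0 s) +
    (h.1.1.2 * x k s + h.1.2 * y k s) + (if k is 0%N then h.2 else 0)) = jet h k.
  by rewrite funeqE => s; rewrite /jet !addrA.
by apply: is_derive_eq hj _; rewrite /jet /= addr0 !addrA.
Qed.

Lemma continuous_jet h k t : I t -> {for t, continuous (jet h k)}.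
Proof. by move=> It; exact/is_derive_continuous/is_derive_jet. Qed.

Hypothesis reg : forall t, I t -> (x 1%N t != 0) || (y 1%N t != 0).

Definition speed2 (t : R) := x 1%N t ^+ 2 + y 1%N t ^+ 2.

Definition speed (t : R) := Num.sqrt (speed2 t).

Lemma speed2_gt0 t : I t -> 0 < speed2 t.
Proof.
move=> /reg /orP[] h; [apply: ltr_pwDl|apply: ltr_wpDl];
  by rewrite ?sqr_ge0 // exprn_even_gt0.
Qed.

Lemma speed_gt0 t : I t -> 0 < speed t.
Proof. by move=> /speed2_gt0; rewrite sqrtr_gt0. Qed.

Lemma speedK t : I t -> speed t ^+ 2 = speed2 t.
Proof. by move=> /speed2_gt0 /ltW h; rewrite sqr_sqrtr. Qed.

Definition curvature (t : R) :=
  (x 1%N t * y 2%N t - y 1%N t * x 2%N t) / speed t ^+ 3.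

(** The numerator of the derivative of the curvature: it vanishes on an
    interval exactly when the curve runs there on one circle or line. *)
Definition curvature_rate (t : R) :=
  speed2 t * (x 1%N t * y 3%N t - y 1%N t * x 3%N t)
  - 3 * (x 1%N t * x 2%N t + y 1%N t * y 2%N t)
      * (x 1%N t * y 2%N t - y 1%N t * x 2%N t).

(** The osculating circle, normalized so that its gradient along the curve is
    the unit normal; in this normalization its four coefficients are constant
    wherever the curvature is. *)
Definition osculating (t : R) : circle_form R :=
  let a := - curvature t / 2 in
  let b := curvature t * x 0%N t - y 1%N t / speed t in
  let c := curvature t * y 0%N t + x 1%N t / speed t in
  (a, b, c, - (a * (x 0%N t ^+ 2 + y 0%N t ^+ 2) + b * x 0%N t + c * y 0%N t)).

Lemma osculating_through t : cf_eval (osculating t) (x 0%N t, y 0%N t) = 0.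
Proof. by rewrite /cf_eval /= subrr. Qed.

Lemma osculating_neq0 t : I t -> osculating t <> cf0 R.
Proof.
move=> It [a0 b0 c0 _]; have := speed_gt0 It => v0.
have k0 : curvature t = 0 by lra.
move: b0 c0; rewrite k0 !mul0r sub0r add0r.
move=> /eqP; rewrite oppr_eq0 mulf_eq0 invr_eq0 (gt_eqF v0) orbF => /eqP b0.
move=> /eqP; rewrite mulf_eq0 invr_eq0 (gt_eqF v0) orbF => /eqP c0.
by have := reg It; rewrite b0 c0 eqxx.
Qed.

(** The gradient of h at the point is normal to the velocity, hence determined
    up to a factor; the second derivative then determines the coefficient of
    x^2 + y^2, and the value at the point the constant term. *)
Lemma contact2_osculating h t : I t ->
  jet h 0 t = 0 -> jet h 1 t = 0 -> jet h 2 t = 0 ->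
  exists m, h = cf_scale m (osculating t).
Proof.
move=> It; have := speed_gt0 It; have := speedK It.
rewrite /jet /= /osculating /curvature /speed2.
move: h (speed t) => [[[a b] c] d] r /=.
set X := x 0%N t; set Y := y 0%N t; set X1 := x 1%N t; set Y1 := y 1%N t.
set X2 := x 2%N t; set Y2 := y 2%N t.
move=> rE r0 j0 j1 j2; rewrite !addr0 in j1 j2.
have rn : r != 0 by rewrite gt_eqF.
(* (B, C) is the gradient of h at the point of the curve. *)
pose B := 2 * a * X + b; pose C := 2 * a * Y + c.
have e1 : B * X1 + C * Y1 = 0 by rewrite /B /C -j1; ring.
have e2 : 2 * a * r ^+ 2 + B * X2 + C * Y2 = 0.
  by rewrite rE /B /C -j2; ring.
pose m := (C * X1 - B * Y1) / r.
have mr : m * r = C * X1 - B * Y1 by rewrite /m divfK.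
have hC : C * r = m * X1.
  apply: (mulIf rn); rewrite [RHS]mulrAC mr -[LHS]mulrA -expr2 rE.
  rewrite -[RHS]addr0 -(mulr0 Y1) -e1; ring.
have hB : B * r = - m * Y1.
  apply: (mulIf rn); rewrite [RHS]mulrAC mulNr mr -[LHS]mulrA -expr2 rE.
  rewrite -[RHS]addr0 -(mulr0 X1) -e1; ring.
have ha : 2 * a * r ^+ 3 = - m * (X1 * Y2 - Y1 * X2).
  have -> : 2 * a * r ^+ 3 = 2 * a * r ^+ 2 * r by ring.
  have -> : 2 * a * r ^+ 2 = - (B * X2 + C * Y2).
    by apply/eqP; rewrite -addr_eq0 addrA e2.
  have -> : - (B * X2 + C * Y2) * r = - (B * r * X2 + C * r * Y2) by ring.
  by rewrite hB hC; ring.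
exists m.
have a_eq : a = m * (- ((X1 * Y2 - Y1 * X2) / r ^+ 3) / 2).
  apply: (mulIf (_ : 2 * r ^+ 3 != 0)); first by rewrite mulf_neq0 ?expf_neq0 ?pnatr_eq0.
  by rewrite mulrCA mulrA ha; field.
have b_eq : b = m * ((X1 * Y2 - Y1 * X2) / r ^+ 3 * X - Y1 / r).
  have -> : b = B - 2 * a * X by rewrite /B; ring.
  have -> : B = - m * Y1 / r by rewrite -hB mulfK.
  by rewrite a_eq; field.
have c_eq : c = m * ((X1 * Y2 - Y1 * X2) / r ^+ 3 * Y + X1 / r).
  have -> : c = C - 2 * a * Y by rewrite /C; ring.
  have -> : C = m * X1 / r by rewrite -hC mulfK.
  by rewrite a_eq; field.
apply: cf_ext => //=.
have -> : d = - (a * (X * X + Y * Y) + b * X + c * Y).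
  by apply/eqP; rewrite -addr_eq0 addrC j0.
by rewrite [in LHS]a_eq [in LHS]b_eq [in LHS]c_eq; ring.
Qed.

Lemma contact2_proportional h h' t : I t -> h <> cf0 R ->
  (forall k, (k <= 2)%N -> jet h k t = 0) ->
  (forall k, (k <= 2)%N -> jet h' k t = 0) ->
  exists m, h' = cf_scale m h.
Proof.
move=> It h0 j j'.
have [m hm] := contact2_osculating It (j 0%N isT) (j 1%N isT) (j 2%N isT).
have [m' hm'] := contact2_osculating It (j' 0%N isT) (j' 1%N isT) (j' 2%N isT).
have m0 : m != 0 by apply/eqP => m0; apply: h0; rewrite hm m0 cf_scale0.
by exists (m' / m); rewrite hm' hm; apply: cf_ext; rewrite /= mulrA divfK.
Qed.

(** Eliminating the gradient of h from the first three derivatives leaves the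
    derivative of the curvature. *)
Lemma contact3_curvature_rate h t : I t -> h <> cf0 R ->
  (forall k, (k <= 3)%N -> jet h k t = 0) -> curvature_rate t = 0.
Proof.
move=> It h0 j; have := reg It; have := speed2_gt0 It.
rewrite /curvature_rate.
have := j 0%N isT; have := j 1%N isT; have := j 2%N isT; have := j 3%N isT.
rewrite /jet /= /speed2 => {j}; move: h h0 => [[[a b] c] d] /=.
set X := x 0%N t; set Y := y 0%N t; set X1 := x 1%N t; set Y1 := y 1%N t.
set X2 := x 2%N t; set Y2 := y 2%N t; set X3 := x 3%N t; set Y3 := y 3%N t.
move=> h0 j3 j2 j1 j0 E0 _; rewrite !addr0 in j3 j2 j1.
pose B := 2 * a * X + b; pose C := 2 * a * Y + c.
pose m := C * X1 - B * Y1; pose E := X1 ^+ 2 + Y1 ^+ 2.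
have e1 : B * X1 + C * Y1 = 0 by rewrite /B /C -j1; ring.
have e2 : 2 * a * E + B * X2 + C * Y2 = 0 by rewrite /B /C /E -j2; ring.
have e3 : 6 * a * (X1 * X2 + Y1 * Y2) + B * X3 + C * Y3 = 0.
  by rewrite /B /C -j3; ring.
have En : E != 0 by rewrite gt_eqF.
have hB : B * E = - m * Y1.
  by rewrite -[RHS]addr0 -(mulr0 X1) -e1 /m /E; ring.
have hC : C * E = m * X1.
  by rewrite -[RHS]addr0 -(mulr0 Y1) -e1 /m /E; ring.
have m0 : m != 0.
  apply/eqP => m0; apply: h0.
  have B0 : B = 0 by apply: (mulIf En); rewrite hB m0; ring.
  have C0 : C = 0 by apply: (mulIf En); rewrite hC m0; ring.
  have a0 : a = 0.
    apply: (mulIf En); move: e2; rewrite B0 C0 !mul0r !addr0 -mulrA => /eqP.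
    by rewrite mulf_eq0 pnatr_eq0 /= => /eqP.
  move: B0 C0 j0; rewrite /B /C a0 !mulr0 !mul0r !add0r => -> ->.
  by rewrite !mul0r !add0r => ->.
apply: (mulfI m0); rewrite mulr0 -/E.
have -> : m * (E * (X1 * Y3 - Y1 * X3) - 3 * (X1 * X2 + Y1 * Y2) * (X1 * Y2 - Y1 * X2))
  = E * ((m * X1) * Y3 + (- m * Y1) * X3)
    - 3 * (X1 * X2 + Y1 * Y2) * ((m * X1) * Y2 + (- m * Y1) * X2) by ring.
rewrite -hB -hC.
have -> : E * (C * E * Y3 + B * E * X3)
    - 3 * (X1 * X2 + Y1 * Y2) * (C * E * Y2 + B * E * X2) =
  E ^+ 2 * (6 * a * (X1 * X2 + Y1 * Y2) + B * X3 + C * Y3)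
  - 3 * (X1 * X2 + Y1 * Y2) * E * (2 * a * E + B * X2 + C * Y2) by ring.
by rewrite e2 e3; ring.
Qed.

Lemma continuous_curvature_rate t : I t -> {for t, continuous curvature_rate}.
Proof.
move=> It; have cx k := is_derive_continuous (dx k It).
have cy k := is_derive_continuous (dy k It).
apply: cvgB; apply: cvgM.
- by apply: cvgD; apply: cvgM; [exact: cx|exact: cx|exact: cy|exact: cy].
- by apply: cvgB; apply: cvgM; [exact: cx|exact: cy|exact: cy|exact: cx].
- apply: cvgM; first exact: cvg_cst.
  by apply: cvgD; apply: cvgM; [exact: cx|exact: cx|exact: cy|exact: cy].
- by apply: cvgB; apply: cvgM; [exact: cx|exact: cy|exact: cy|exact: cx].
Qed.

End Jets.

(** * Curves of constant curvature *)

Section CircularArcs.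
Variables (R : realType) (x y : nat -> R -> R) (I : set R).
Hypothesis oI : open I.
Hypothesis dx : forall k t, I t -> is_derive t (1 : R) (x k) (x k.+1 t).
Hypothesis dy : forall k t, I t -> is_derive t (1 : R) (y k) (y k.+1 t).
Hypothesis reg : forall t, I t -> (x 1%N t != 0) || (y 1%N t != 0).

Local Notation jet := (jet x y).
Local Notation rate := (curvature_rate x y).
Local Notation osculating := (osculating x y).
Local Notation speed := (speed x y).
Local Notation curvature := (curvature x y).

Lemma is_derive_speed t : I t -> is_derive t (1 : R) speed
  ((x 1%N t * x 2%N t + y 1%N t * y 2%N t) / speed t).
Proof.
move=> It; have v2 := speed2_gt0 reg It; have v0 := speed_gt0 reg It.
have d2 : is_derive t (1 : R) (speed2 x y)
    (2 * (x 1%N t * x 2%N t + y 1%N t * y 2%N t)).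
  have := is_derive_add (is_derive_mul (dx 1 It) (dx 1 It)) (is_derive_mul (dy 1 It) (dy 1 It)).
  by move=> /is_derive_eq; apply; ring.
have := is_derive1_comp (is_derive1_sqrt v2) d2.
move=> /is_derive_eq; apply; rewrite -/(speed t).
by field; rewrite gt_eqF.
Qed.

Lemma is_derive_unit_tangent (z : nat -> R -> R) t : I t ->
  is_derive t (1 : R) (z 1%N) (z 2%N t) ->
  is_derive t (1 : R) (fun s => z 1%N s / speed s)
    ((z 2%N t * speed t - z 1%N t *
       ((x 1%N t * x 2%N t + y 1%N t * y 2%N t) / speed t)) / speed t ^+ 2).
Proof.
move=> It dz; apply: is_derive_div dz (is_derive_speed It).
by rewrite gt_eqF ?(speed_gt0 reg).
Qed.

Lemma is_derive_curvature t : I t ->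
  is_derive t (1 : R) curvature (rate t / speed t ^+ 5).
Proof.
move=> It; have v0 := speed_gt0 reg It; have vK := speedK reg It.
have vn : speed t != 0 by rewrite gt_eqF.
have dv := is_derive_speed It.
have dv3 := is_derive_mul dv (is_derive_mul dv dv).
have dd := is_derive_add (is_derive_mul (dx 1 It) (dy 2 It))
  (is_derive_mulc (-1) (is_derive_mul (dy 1 It) (dx 2 It))).
have := is_derive_div _ dd dv3; rewrite !mulf_neq0 // => /(_ isT) h.
have <- : (fun s => (x 1%N s * y 2%N s + -1 * (y 1%N s * x 2%N s)) /
   (speed s * (speed s * speed s))) = curvature.
  by rewrite funeqE => s; rewrite /curvature mulN1r -!expr2 -exprS.
apply: is_derive_eq h _; rewrite /rate -vK.
by field.
Qed.

(** By the Frenet formulas, the derivatives of the coefficients are multiples of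
    the derivative of the curvature. *)
Lemma osculating_cst A : A `<=` I -> is_interval A ->
  (forall t, A t -> rate t = 0) ->
  forall s t, A s -> A t -> osculating s = osculating t.
Proof.
move=> AI itvA W0 s t As At.
have kE u v : A u -> A v -> curvature u = curvature v.
  apply: derive0_cst itvA _ _ _ => r Ar.
  by apply: is_derive_eq (is_derive_curvature (AI _ Ar)) _; rewrite W0 // mul0r.
pose k := curvature s.
have bE u v : A u -> A v ->
    k * x 0%N u - y 1%N u / speed u = k * x 0%N v - y 1%N v / speed v.
  apply: (derive0_cst (f := fun u => k * x 0%N u - y 1%N u / speed u)) itvA _ _ _.
  move=> r Ar; have Ir := AI _ Ar.
  have h := is_derive_add (is_derive_mulc k (dx 0 Ir))
    (is_derive_mulc (-1) (is_derive_unit_tangent Ir (dy 1 Ir))).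
  have v0 := speed_gt0 reg Ir; have vK := speedK reg Ir.
  have <- : (fun u => k * x 0%N u + -1 * (y 1%N u / speed u)) =
     (fun u => k * x 0%N u - y 1%N u / speed u).
    by rewrite funeqE => q; rewrite mulN1r.
  apply: is_derive_eq h _; rewrite /k (kE s r As Ar) /curvature.
  move: vK; rewrite /speed2; move: (speed r) v0 => p v0 vK.
  have vn : p != 0 by rewrite gt_eqF.
  apply: (mulIf (expf_neq0 3 vn)); rewrite mul0r.
  transitivity ((x 1%N r * y 2%N r - y 1%N r * x 2%N r) * x 1%N r
    - y 2%N r * p ^+ 2 + y 1%N r * (x 1%N r * x 2%N r + y 1%N r * y 2%N r)).
    by field.
  by rewrite vK; ring.
have cE u v : A u -> A v ->
    k * y 0%N u + x 1%N u / speed u = k * y 0%N v + x 1%N v / speed v.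
  apply: (derive0_cst (f := fun u => k * y 0%N u + x 1%N u / speed u)) itvA _ _ _.
  move=> r Ar; have Ir := AI _ Ar.
  have h := is_derive_add (is_derive_mulc k (dy 0 Ir))
    (is_derive_unit_tangent Ir (dx 1 Ir)).
  have v0 := speed_gt0 reg Ir; have vK := speedK reg Ir.
  apply: is_derive_eq h _; rewrite /k (kE s r As Ar) /curvature.
  move: vK; rewrite /speed2; move: (speed r) v0 => p v0 vK.
  have vn : p != 0 by rewrite gt_eqF.
  apply: (mulIf (expf_neq0 3 vn)); rewrite mul0r.
  transitivity ((x 1%N r * y 2%N r - y 1%N r * x 2%N r) * y 1%N r
    + x 2%N r * p ^+ 2 - x 1%N r * (x 1%N r * x 2%N r + y 1%N r * y 2%N r)).
    by field.
  by rewrite vK; ring.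
pose a := - k / 2; pose b := k * x 0%N s - y 1%N s / speed s.
pose c := k * y 0%N s + x 1%N s / speed s.
pose h : circle_form R := (a, b, c, 0).
have hE u : A u -> osculating u = (a, b, c, - jet h 0 u).
  move=> Au; rewrite /osculating -(kE s u As Au) -/k.
  by rewrite (bE u s Au As) (cE u s Au As) -/b -/c jet0E /cf_eval /= addr0.
have j0 : jet h 0 s = jet h 0 t.
  apply: (derive0_cst itvA _ As At) => r Ar; have Ir := AI _ Ar.
  apply: is_derive_eq (is_derive_jet dx dy h 0 Ir) _.
  have v0 := speed_gt0 reg Ir.
  have -> : h = (a, k * x 0%N r - y 1%N r / speed r,
      k * y 0%N r + x 1%N r / speed r, 0).
    by rewrite /h /b /c (bE s r As Ar) (cE s r As Ar).
  by rewrite /jet /= /a; field; rewrite gt_eqF.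
by rewrite !hE // j0.
Qed.

(** Where its curvature is constant the curve runs on its osculating circle at b,
    and this is the circle of h. *)
Lemma contact2_arc A h b : A `<=` I -> is_interval A ->
  (forall t, A t -> rate t = 0) -> A b ->
  (forall k, (k <= 2)%N -> jet h k b = 0) -> forall t, A t -> jet h 0 t = 0.
Proof.
move=> AI itvA W0 Ab jb t At.
have [m ->] := contact2_osculating reg (AI _ Ab) (jb 0%N isT) (jb 1%N isT) (jb 2%N isT).
rewrite jet_scale jet0E (osculating_cst AI itvA W0 Ab At).
by rewrite osculating_through mulr0.
Qed.

Lemma curvature_rate0_arc : is_interval I -> I !=set0 ->
  (forall t, I t -> rate t = 0) ->
  exists2 h, h <> cf0 R & forall t, I t -> jet h 0 t = 0.
Proof.
move=> itvI [t0 It0] W0; exists (osculating t0); first exact: osculating_neq0 reg _ It0.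
move=> t It; rewrite jet0E (osculating_cst (@subset_refl _ I) itvI W0 It0 It).
exact: osculating_through.
Qed.

Lemma near_domain t : I t -> \forall s \near t, I s.
Proof. by move=> It; exact: open_nbhs_nbhs. Qed.

Lemma jet_near0 h t : I t -> (\forall s \near t, jet h 0 s = 0) ->
  forall k, jet h k t = 0.
Proof.
move=> It h0 k; suff : \forall s \near t, jet h k s = 0 by exact: nbhs_singleton.
elim: k => // k /near_join IH.
near=> s; have Is : I s by near: s; exact: near_domain.
apply: is_derive_unique (is_derive_jet dx dy h k Is) _.
apply: near_eq_is_derive (is_derive_cst (0 : R) s 1).
have : \forall r \near s, jet h k r = 0 by near: s.
by apply: filterS => r ->.
Unshelve. all: by end_near.
Qed.

Lemma arc_curvature_rate h t : I t -> h <> cf0 R ->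
  (\forall s \near t, jet h 0 s = 0) -> rate t = 0.
Proof.
move=> It h0 jh; apply: (contact3_curvature_rate reg It h0) => k _.
exact: jet_near0.
Qed.

Lemma continuous_neq0 (f : R -> R) (t : R) : {for t, continuous f} ->
  f t != 0 -> \forall s \near t, f s != 0.
Proof. by move=> cf f0; exact: cvgr_neq0 cf f0. Qed.

Lemma continuous_eq0 (f : R -> R) (t : R) : {for t, continuous f} ->
  (forall P, nbhs t P -> exists2 s, P s & f s = 0) -> f t = 0.
Proof.
move=> cf fP; apply/eqP/negPn/negP => f0.
have nf : \forall s \near t, f s != 0 by exact: continuous_neq0.
by have [s /= /eqP] := fP _ nf.
Qed.

(** A smooth curve cannot change from one circle to another: the derivative
    of its curvature vanishes on a dense set, hence everywhere. *)
Lemma two_circles_one_circle h h' : is_interval I -> I !=set0 ->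
  h <> cf0 R -> h' <> cf0 R ->
  (forall t, I t -> jet h 0 t * jet h' 0 t = 0) ->
  exists2 h, h <> cf0 R & forall t, I t -> jet h 0 t = 0.
Proof.
move=> itvI I0 hn hn' hh'; apply: curvature_rate0_arc => // t It.
have off s : I s -> jet h 0 s != 0 -> rate s = 0.
  move=> Is hs; apply: (arc_curvature_rate Is hn').
  have hs' : \forall r \near s, jet h 0 r != 0.
    exact: (continuous_neq0 (continuous_jet dx dy Is)).
  apply: filterS2 hs' (near_domain Is) => r hr Ir.
  by have /eqP := hh' r Ir; rewrite mulf_eq0 (negbTE hr) => /eqP.
apply: continuous_eq0 (continuous_curvature_rate dx dy It) _ => P nP.
have [[s [Ps Is hs]]|noS] := pselect (exists s, [/\ P s, I s & jet h 0 s != 0]).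
  by exists s => //; exact: off.
exists t; first exact: nbhs_singleton.
apply: (arc_curvature_rate It hn).
apply: filterS2 nP (near_domain It) => s Ps Is.
by apply/eqP/negPn/negP => hs; apply: noS; exists s.
Qed.

End CircularArcs.

(** * Curves tangent to a quadratic family of circles *)

Section FiniteOrder.
Variable R : realType.

(** By Taylor's formula: the first nonzero term of the 2-jet dominates. *)
Lemma order2_lower_bound (F : nat -> R -> R) (b : R) :
  (forall k, \forall t \near b, is_derive t (1 : R) (F k) (F k.+1 t)) ->
  ~ (forall k, (k <= 2)%N -> F k b = 0) ->
  exists2 c, 0 < c & \forall t \near b, c * `|t - b| ^+ 2 <= `|F 0 t|.
Proof.
move=> dF F0.
pose p0 := F 0%N b; pose p1 := F 1%N b; pose p2 := F 2%N b.
pose T k t : R := match k with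
  | 0%N => p0 + p1 * (t - b) + p2 / 2 * (t - b) ^+ 2
  | 1%N => p1 + p2 * (t - b) | 2%N => p2 | _ => 0 end.
have dT k t : is_derive t (1 : R) (T k) (T k.+1 t).
  have d1 : is_derive t (1 : R) (fun s : R => s - b) 1.
    have := is_derive_add (is_derive_id t (1 : R)) (is_derive_cst (- b) t (1 : R)).
    by rewrite addr0.
  case: k => [|[|[|k]]] /=; try exact: is_derive_cst.
  - have h1 := is_derive_add (is_derive_cst p0 t (1 : R)) (is_derive_mulc p1 d1).
    have h2 := is_derive_mulc (p2 / 2) (is_derive_mul d1 d1).
    by apply: is_derive_eq (is_derive_add h1 h2) _; field.
  - have h1 := is_derive_add (is_derive_cst p1 t (1 : R)) (is_derive_mulc p2 d1).
    by apply: is_derive_eq h1 _; rewrite mulr1 add0r.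
pose G k t := F k t + -1 * T k t.
have hG : forall e, 0 < e -> \forall t \near b, `|G 0%N t| <= e * `|t - b| ^+ 2.
  apply: flat_little_o => k.
    by apply: filterS (dF k) => t ht; exact: is_derive_add ht (is_derive_mulc _ (dT k t)).
  case: k => [|[|[|//]]] _; rewrite /G /T ?subrr ?expr0n ?mulr0 ?addr0 mulN1r;
    by rewrite ?mulr0 ?addr0 subrr.
have near_small (r : R) : 0 < r -> \forall t \near b, `|t - b| < r.
  move=> r0; apply/nbhs_ballP; exists r => //= t.
  by rewrite /ball /= distrC.
have norm_quad t : `|p2 / 2 * (t - b) ^+ 2| = `|p2| / 2 * `|t - b| ^+ 2.
  by rewrite normrM normrX normrM (ger0_norm (_ : 0 <= 2^-1)) ?invr_ge0.
(* The three cases are those of a zero of order 0, 1 and 2; M bounds the terms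
   following the dominant one. *)
have [p00|p0n] := eqVneq p0 0; last first.
  have q0 : 0 < `|p0| by rewrite normr_gt0.
  exists (`|p0| / 4); first by rewrite divr_gt0.
  pose M := `|p1| + `|p2| / 2 + 1 + `|p0|.
  have M0 : 0 < M by rewrite /M; have := normr_ge0 p1; have := normr_ge0 p2; lra.
  have r0 : 0 < `|p0| / (4 * M) by rewrite divr_gt0 // mulr_gt0.
  near=> t.
  have h : `|G 0%N t| <= 1 * `|t - b| ^+ 2 by near: t; exact: hG.
  have h1 : `|t - b| < 1 by near: t; exact: near_small.
  have h2 : `|t - b| < `|p0| / (4 * M) by near: t; exact: near_small.
  move: h h1 h2; set d := `|t - b| => h h1 h2.
  have d0 : 0 <= d by rewrite normr_ge0.
  have dd : d ^+ 2 <= d by rewrite expr2 ler_piMr // ltW.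
  have Md : M * d <= `|p0| / 4.
    have : M * d <= M * (`|p0| / (4 * M)) by rewrite ler_wpM2l // ltW.
    by congr (_ <= _); field; rewrite gt_eqF.
  have eF : F 0%N t = p0 + (p1 * (t - b) + p2 / 2 * (t - b) ^+ 2 + G 0%N t).
    by rewrite /G /T; ring.
  have n1 : `|p1 * (t - b) + p2 / 2 * (t - b) ^+ 2 + G 0%N t| <= `|p0| / 4.
    apply: le_trans (ler_normD _ _) _.
    apply: (le_trans (lerD (ler_normD _ _) h)).
    rewrite norm_quad normrM -/d.
    have := normr_ge0 p1; have := normr_ge0 p2 => a2 a1.
    have b2 : `|p2| * 2^-1 * d ^+ 2 <= `|p2| * 2^-1 * d by rewrite ler_wpM2l // mulr_ge0 // invr_ge0.
    have b0 : 0 <= `|p0| * d by rewrite mulr_ge0.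
    by move: Md; rewrite /M; lra.
  have n2 : `|p0| <= `|F 0%N t| + `|p1 * (t - b) + p2 / 2 * (t - b) ^+ 2 + G 0%N t|.
    by rewrite eF; set z := p1 * (t - b) + _ + _; have := ler_normB (p0 + z) z; rewrite addrK.
  have dd1 : d ^+ 2 <= 1 by rewrite (le_trans dd) // ltW.
  have : `|p0| / 4 * d ^+ 2 <= `|p0| / 4 by rewrite ler_piMr // ltW // divr_gt0.
  lra.
have [p10|p1n] := eqVneq p1 0; last first.
  have q0 : 0 < `|p1| by rewrite normr_gt0.
  exists (`|p1| / 4); first by rewrite divr_gt0.
  pose M := `|p2| / 2 + 1.
  have M0 : 0 < M by rewrite /M; have := normr_ge0 p2; lra.
  have r0 : 0 < `|p1| / (4 * M) by rewrite divr_gt0 // mulr_gt0.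
  near=> t.
  have h : `|G 0%N t| <= 1 * `|t - b| ^+ 2 by near: t; exact: hG.
  have h1 : `|t - b| < 1 by near: t; exact: near_small.
  have h2 : `|t - b| < `|p1| / (4 * M) by near: t; exact: near_small.
  move: h h1 h2; set d := `|t - b| => h h1 h2.
  have d0 : 0 <= d by rewrite normr_ge0.
  have Md : M * d <= `|p1| / 4.
    have : M * d <= M * (`|p1| / (4 * M)) by rewrite ler_wpM2l // ltW.
    by congr (_ <= _); field; rewrite gt_eqF.
  have eF : F 0%N t = p1 * (t - b) + (p2 / 2 * (t - b) ^+ 2 + G 0%N t).
    by rewrite /G /T p00; ring.
  have n1 : `|p2 / 2 * (t - b) ^+ 2 + G 0%N t| <= `|p1| / 4 * d.
    apply: (le_trans (ler_normD _ _)).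
    apply: (le_trans (lerD (lexx _) h)).
    rewrite norm_quad -/d.
    have : M * d * d <= `|p1| / 4 * d by rewrite ler_wpM2r.
    by congr (_ <= _); rewrite /M expr2; ring.
  have n2 : `|p1| * d <= `|F 0%N t| + `|p2 / 2 * (t - b) ^+ 2 + G 0%N t|.
    rewrite -normrM eF; set z := p2 / 2 * (t - b) ^+ 2 + G 0%N t.
    by have := ler_normB (p1 * (t - b) + z) z; rewrite addrK.
  have b1 : `|p1| / 4 * d ^+ 2 <= `|p1| / 4 * d.
    by rewrite expr2 mulrA ler_piMr ?mulr_ge0 // ?ltW // divr_gt0.
  have b2 : 0 <= `|p1| / 4 * d by rewrite mulr_ge0 // ltW // divr_gt0.
  lra.
have p2n : p2 != 0.
  apply/eqP => p20; apply: F0 => -[|[|[|//]]] _; [exact: p00|exact: p10|exact: p20].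
have q0 : 0 < `|p2| by rewrite normr_gt0.
exists (`|p2| / 4); first by rewrite divr_gt0.
near=> t.
have h : `|G 0%N t| <= `|p2| / 4 * `|t - b| ^+ 2.
  by near: t; apply: hG; rewrite divr_gt0.
have eF : p2 / 2 * (t - b) ^+ 2 = F 0%N t - G 0%N t by rewrite /G /T p00 p10; ring.
have : `|p2| / 2 * `|t - b| ^+ 2 <= `|F 0%N t| + `|G 0%N t|.
  by rewrite -norm_quad eF; exact: ler_normB.
lra.
Unshelve. all: by end_near.
Qed.

End FiniteOrder.

Section StationaryBranch.
Variables (R : realType) (U : set R).

(** Where f is not stationary, the element of U is the value of g, on a whole
    interval, so that g is constant there. If f is stationary everywhere, then
    f is constant; if moreover its value is never the element of U, then the
    value of g always is, and g is constant as well. *)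
Lemma stationary_branch (A : set R) (f g df dg : R -> R) :
  open A -> is_interval A -> A !=set0 ->
  (forall t, A t -> is_derive t (1 : R) f (df t)) ->
  (forall t, A t -> is_derive t (1 : R) g (dg t)) ->
  (forall t, A t -> {for t, continuous df}) ->
  (forall t, A t -> exists2 u, U u & u = f t /\ df t = 0 \/ u = g t /\ dg t = 0) ->
  exists2 s, A s & exists2 u, U u &
    (\forall t \near s, f t = u) \/ (\forall t \near s, g t = u).
Proof.
move=> oA itvA [t0 At0] hf hg cdf hU.
have nA t : A t -> \forall s \near t, A s by move=> At; exact: open_nbhs_nbhs.
have [[t [At ht]]|df0] := pselect (exists t, A t /\ df t != 0).
  have nt : \forall s \near t, df s != 0 by exact: continuous_neq0 (cdf t At) ht.
  have [r /= r0 hr] := (nbhs_ballP _ _).1 (filterI nt (nA _ At)).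
  have hs s : ball t r s -> exists2 u, U u & u = g s /\ dg s = 0.
    move=> /hr[/= s1 s2]; have [u Uu [[_ s3]|s3]] := hU s s2; last by exists u.
    by rewrite s3 eqxx in s1.
  exists t => //; have [u Uu [ug _]] := hs t (ballxx t r0).
  exists u => //; right; apply/nbhs_ballP; exists r => //= s bs; rewrite ug.
  apply: derive0_cst (@is_interval_ball R t r) _ _ _ bs (ballxx t r0) => v bv.
  by apply: is_derive_eq (hg v (hr v bv).2) _; have [? _ []] := hs v bv.
have {}df0 t : A t -> df t = 0.
  by move=> At; apply/eqP/negPn/negP => h; apply: df0; exists t.
have fE s t : A s -> A t -> f s = f t.
  apply: derive0_cst itvA _ _ _ => v Av.
  by apply: is_derive_eq (hf v Av) _; exact: df0.
have [[t [At [u Uu uf]]]|nof] := pselect (exists t, A t /\ exists2 u, U u & u = f t).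
  exists t => //; exists u => //; left; apply: filterS (nA t At) => s As.
  by rewrite uf; exact: fE.
have hs s : A s -> exists2 u, U u & u = g s /\ dg s = 0.
  move=> As; have [u Uu [[uf _]|?]] := hU s As; last by exists u.
  by case: nof; exists s; split=> //; exists u.
have [u Uu [ug _]] := hs t0 At0.
exists t0 => //; exists u => //; right; apply: filterS (nA t0 At0) => s As.
rewrite ug; apply: derive0_cst itvA _ _ _ As At0 => v Av.
by apply: is_derive_eq (hg v Av) _; have [? _ []] := hs v Av.
Qed.

End StationaryBranch.

Section TangentFamily.
Variable R : realType.
Variables q0 q1 q2 : circle_form R.

Definition member (u : R) : circle_form R :=
  cf_lin 1 (cf_lin 1 q0 u q1) (u ^+ 2) q2.

Definition member_rate (u : R) : circle_form R := cf_lin 1 q1 (2 * u) q2.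

Definition discriminant (w : R * R) : R :=
  cf_eval q1 w ^+ 2 - 4 * cf_eval q0 w * cf_eval q2 w.

Lemma member_eval u w :
  cf_eval (member u) w = cf_eval q0 w + u * cf_eval q1 w + u ^+ 2 * cf_eval q2 w.
Proof. by rewrite !cf_eval_lin !mul1r. Qed.

(** Taylor expansion at u: on the member of parameter u the discriminant is the
    square of a circle form. *)
Lemma discriminantE u w : discriminant w =
  cf_eval (member_rate u) w ^+ 2 - 4 * cf_eval q2 w * cf_eval (member u) w.
Proof. by rewrite member_eval cf_eval_lin /discriminant; ring. Qed.

Variables (x y : nat -> R -> R) (I U : set R).
Hypothesis oI : open I.
Hypothesis itvI : is_interval I.
Hypothesis dx : forall k t, I t -> is_derive t (1 : R) (x k) (x k.+1 t).
Hypothesis dy : forall k t, I t -> is_derive t (1 : R) (y k) (y k.+1 t).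
Hypothesis reg : forall t, I t -> (x 1%N t != 0) || (y 1%N t != 0).
Hypothesis member_neq0 : forall u, U u -> member u <> cf0 R.

Local Notation jet := (jet x y).
Local Notation rate := (curvature_rate x y).
Local Notation point t := (x 0%N t, y 0%N t).

Lemma jet_member u k t :
  jet (member u) k t = jet q0 k t + u * jet q1 k t + u ^+ 2 * jet q2 k t.
Proof. by rewrite !jet_lin !mul1r. Qed.

Hypothesis tangent : forall t, I t ->
  exists2 u, U u & jet (member u) 0 t = 0 /\ jet (member u) 1 t = 0.

Let nI t (It : I t) : \forall s \near t, I s := near_domain oI It.

Lemma continuous_discriminant t : I t ->
  {for t, continuous (fun s => discriminant (point s))}.
Proof.
move=> It; have cq q := continuous_jet dx dy (h := q) (k := 0) It.
have -> : (fun s => discriminant (point s)) =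
    (fun s => jet q1 0 s ^+ 2 - 4 * jet q0 0 s * jet q2 0 s).
  by rewrite funeqE => s; rewrite !jet0E.
apply: cvgB; first by apply: cvgM; exact: cq.
by apply: cvgM; [apply: cvgM; [exact: cvg_cst|exact: cq]|exact: cq].
Qed.

Lemma near_discriminant t : I t -> discriminant (point t) != 0 ->
  \forall s \near t, discriminant (point s) != 0.
Proof. by move=> It; exact: (continuous_neq0 (continuous_discriminant It)). Qed.

(** Off the discriminant, solving for the parameter as a function of the point
    of tangency gives one or two smooth branches. Differentiating the equation of
    the family along a branch shows that tangency means stationarity of the
    parameter. *)
Lemma constant_parameter t (P : set R) : I t -> discriminant (point t) != 0 ->
  nbhs t P ->
  exists2 s, P s & I s /\ exists2 u, U u & \forall r \near s, jet (member u) 0 r = 0.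
Proof.
move=> It Dt nP.
have [e /= e0 he] := (nbhs_ballP _ _).1
  (filterI nP (filterI (nI It) (near_discriminant It Dt))).
have D0 s : ball t e s -> 0 < discriminant (point s).
  move=> /he[_ [Is]]; rewrite lt_def => -> /=.
  have [u _ [ju _]] := tangent Is.
  by rewrite (discriminantE u) -!jet0E ju mulr0 subr0 sqr_ge0.
have DE s : discriminant (point s) = jet q1 0 s ^+ 2 - 4 * jet q0 0 s * jet q2 0 s.
  by rewrite !jet0E.
(* If q2 vanishes along the curve, then the equation is linear in u; otherwise
   it is enough to study the curve near a point where q2 does not vanish. *)
have [[t1 [bt1 Q2]]|noQ2] := pselect (exists s, ball t e s /\ jet q2 0 s != 0); last first.
  have Q2 s : ball t e s -> jet q2 0 s = 0.
    by move=> bs; apply/eqP/negPn/negP => h; apply: noQ2; exists s.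
  have Q2' s : ball t e s -> jet q2 1 s = 0.
    move=> bs; have [_ [Is _]] := he s bs.
    apply: (jet_near0 oI dx dy Is).
    by apply: filterS (open_nbhs_nbhs (conj (ball_open t e) bs)) => r; exact: Q2.
  have Q1 s : ball t e s -> jet q1 0 s != 0.
    move=> bs; have := D0 s bs; rewrite DE (Q2 s bs) mulr0 subr0 => /lt0r_neq0.
    by rewrite sqrf_eq0.
  pose f s := - jet q0 0 s / jet q1 0 s.
  have rootE s : ball t e s -> jet (member (f s)) 0 s = 0.
    move=> bs; rewrite jet_member (Q2 s bs) /f; field; exact: Q1.
  pose df s := - jet (member (f s)) 1 s / jet q1 0 s.
  have hf s : ball t e s -> is_derive s (1 : R) f (df s).
    move=> bs; have [_ [Is _]] := he s bs.
    have := is_derive_div (Q1 s bs) (is_derive_mulc (-1) (is_derive_jet dx dy q0 0 Is))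
      (is_derive_jet dx dy q1 0 Is).
    have -> : (fun s => -1 * jet q0 0 s / jet q1 0 s) = f.
      by rewrite funeqE => r; rewrite mulN1r.
    move=> /is_derive_eq; apply; rewrite /df jet_member (Q2' s bs) /f.
    by field; exact: Q1.
  have hU s : ball t e s -> exists2 u, U u & u = f s /\ df s = 0.
    move=> bs; have [_ [Is _]] := he s bs; have [u Uu [j0 j1]] := tangent Is.
    have uf : u = f s.
      move: j0; rewrite jet_member (Q2 s bs) mulr0 addr0 => /eqP.
      rewrite addrC addr_eq0 => /eqP h; apply: (mulIf (Q1 s bs)).
      by rewrite h /f divfK // Q1.
    by exists u => //; split=> //; rewrite /df -uf j1 oppr0 mul0r.
  have bt := ballxx t e0; have [u Uu [uf _]] := hU t bt.
  exists t; first exact: nbhs_singleton.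
  split => //; exists u => //; apply/nbhs_ballP; exists e => //= s bs.
  have -> : u = f s.
    rewrite uf; apply: derive0_cst (@is_interval_ball R t e) _ _ _ bt bs => r br.
    by have [v _ [_ h]] := hU r br; rewrite -h; exact: hf.
  exact: rootE.
have [_ [It1 _]] := he t1 bt1.
have [e1 /= e10 he1] := (nbhs_ballP _ _).1 (filterI (open_nbhs_nbhs (conj (ball_open t e) bt1))
  (continuous_neq0 (continuous_jet dx dy It1) Q2)).
pose r s := Num.sqrt (discriminant (point s)).
have r0 s : ball t1 e1 s -> r s != 0.
  by move=> /he1[/D0 h _]; rewrite gt_eqF // sqrtr_gt0.
have rK s : ball t1 e1 s -> r s ^+ 2 = jet q1 0 s ^+ 2 - 4 * jet q0 0 s * jet q2 0 s.
  by move=> /he1[/D0 /ltW h _]; rewrite sqr_sqrtr ?DE.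
have Is1 s : ball t1 e1 s -> I s by move=> /he1[/he[_ []]].
have Q2n s : ball t1 e1 s -> jet q2 0 s != 0 by move=> /he1[].
have hr s : ball t1 e1 s -> is_derive s (1 : R) r
  ((jet q1 0 s * jet q1 1 s - 2 * jet q0 1 s * jet q2 0 s
    - 2 * jet q0 0 s * jet q2 1 s) / r s).
  move=> bs; have Is := Is1 s bs.
  have dq q := is_derive_jet dx dy q 0 Is.
  have h := is_derive_add (is_derive_mul (dq q1) (dq q1))
    (is_derive_mulc (-4) (is_derive_mul (dq q0) (dq q2))).
  have E : (fun s => jet q1 0 s * jet q1 0 s + -4 * (jet q0 0 s * jet q2 0 s)) =
      (fun s => discriminant (point s)).
    by rewrite funeqE => v; rewrite DE; ring.
  rewrite E in h; have Ds : 0 < discriminant (point s) by have [/D0] := he1 s bs.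
  have := @is_derive1_comp _ _ (fun v => discriminant (point v)) s _ _ (is_derive1_sqrt Ds) h.
  move=> /is_derive_eq; apply; rewrite -/(r s).
  by field; exact: r0.
(* The two roots, for c = 1 and c = -1. *)
pose f (c s : R) := (- jet q1 0 s + c * r s) / (2 * jet q2 0 s).
pose df (c s : R) := - c * jet (member (f c s)) 1 s / r s.
have hf c s : c ^+ 2 = 1 -> ball t1 e1 s -> is_derive s (1 : R) (f c) (df c s).
  move=> c1 bs; have Is := Is1 s bs; have dq q := is_derive_jet dx dy q 0 Is.
  have n2 : 2 * jet q2 0 s != 0 by rewrite mulf_neq0 ?pnatr_eq0 ?Q2n.
  have := is_derive_div (g := fun v => 2 * jet q2 0 v) n2 (is_derive_add (is_derive_mulc (-1) (dq q1))
    (is_derive_mulc c (hr s bs))) (is_derive_mulc 2 (dq q2)).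
  have -> : (fun s => (-1 * jet q1 0 s + c * r s) / (2 * jet q2 0 s)) = f c.
    by rewrite funeqE => v; rewrite /f mulN1r.
  move=> /is_derive_eq; apply; rewrite /df jet_member /f.
  have q0E : jet q0 0 s = (jet q1 0 s ^+ 2 - r s ^+ 2) / (4 * jet q2 0 s).
    by rewrite rK //; field; exact: Q2n.
  have := r0 s bs; have := Q2n s bs; rewrite q0E.
  move: c1 => /eqP; rewrite sqrf_eq1 => /orP[] /eqP -> bn vn; field; exact/andP.
have rootE c s : c ^+ 2 = 1 -> ball t1 e1 s -> jet (member (f c s)) 0 s = 0.
  move=> c1 bs; rewrite jet_member /f.
  have q0E : jet q0 0 s = (jet q1 0 s ^+ 2 - c ^+ 2 * r s ^+ 2) / (4 * jet q2 0 s).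
    by rewrite c1 mul1r rK //; field; exact: Q2n.
  by rewrite q0E; field; exact: Q2n.
have cdf c s : c ^+ 2 = 1 -> ball t1 e1 s -> {for s, continuous (df c)}.
  move=> c1 bs; have Is := Is1 s bs.
  have cj q k := continuous_jet dx dy (h := q) (k := k) Is.
  have cf := is_derive_continuous (hf c s c1 bs).
  have cr := is_derive_continuous (hr s bs).
  have -> : df c = (fun s => - c * (jet q0 1 s + f c s * jet q1 1 s
      + f c s ^+ 2 * jet q2 1 s) * (r s)^-1).
    by rewrite funeqE => v; rewrite /df jet_member.
  apply: cvgM; last by apply: cvgV; [exact: r0|exact: cr].
  apply: cvgM; first exact: cvg_cst.
  apply: cvgD; [apply: cvgD; first exact: cj|].
    by apply: cvgM; [exact: cf|exact: cj].
  by apply: cvgM; [apply: cvgM; exact: cf|exact: cj].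
have s1 : (1 : R) ^+ 2 = 1 by rewrite expr1n.
have sN1 : (-1 : R) ^+ 2 = 1 by rewrite sqrrN expr1n.
have [|s bs [u Uu hu]] := @stationary_branch _ U (ball t1 e1) (f 1) (f (-1)) (df 1) (df (-1))
  (ball_open _ _) (@is_interval_ball R t1 e1) (ex_intro _ t1 (ballxx t1 e10))
  (fun s bs => hf 1 s s1 bs) (fun s bs => hf (-1) s sN1 bs) (fun s bs => cdf 1 s s1 bs).
  move=> s bs; have [u Uu [j0 j1]] := tangent (Is1 s bs).
  exists u => //; move: j0; rewrite jet_member => j0.
  have : (u - f 1 s) * (u - f (-1) s) = 0.
    have n2 := Q2n s bs.
    apply: (mulfI n2); rewrite mulr0 -j0 /f.
    have -> : jet q0 0 s = (jet q1 0 s ^+ 2 - r s ^+ 2) / (4 * jet q2 0 s).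
      by rewrite rK //; field.
    by field.
  move=> /eqP; rewrite mulf_eq0 !subr_eq0 => /orP[] /eqP uf; [left|right];
    by split=> //; rewrite /df -uf j1 mulr0 mul0r.
have [bs' _] := he1 s bs; have [Ps [Is _]] := he s bs'.
exists s => //; split=> //; exists u => //.
have nb := open_nbhs_nbhs (conj (ball_open t1 e1) bs).
by case: hu => hu; apply: filterS2 hu nb => v <- bv; exact: rootE.
Qed.

(** Circular arcs of the curve are dense off the discriminant. *)
Lemma discriminant_curvature_rate t : I t -> discriminant (point t) != 0 -> rate t = 0.
Proof.
move=> It Dt; apply: continuous_eq0 (continuous_curvature_rate dx dy It) _ => P nP.
have [s Ps [Is [u Uu hu]]] := constant_parameter It Dt nP.
by exists s => //; exact: (arc_curvature_rate oI dx dy reg Is (member_neq0 Uu)).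
Qed.

(** Where the curve might leave the member h, it has contact of infinite order
    with it. Along h the discriminant is the square of a circle form that is not
    a multiple of h, for it does not vanish at t0; so this form has contact of
    order at most 1 with the curve, and the discriminant does not vanish at
    other nearby points. Hence the derivative of the curvature vanishes near the
    point, and the curve stays on h. *)
Lemma arc_extends u t0 : U u -> I t0 -> discriminant (point t0) != 0 ->
  (\forall s \near t0, jet (member u) 0 s = 0) ->
  forall t, I t -> jet (member u) 0 t = 0.
Proof.
move=> Uu It0 Dt0 nt0; set h := member u in nt0 *.
pose S := [set s | jet h 0 s = 0].
have /connected_intervalP cI := itvI.
suff : I `&` interior S = I.
  move=> IS t It; have : (I `&` interior S) t by rewrite IS.
  by move=> [_ /interior_subset].
apply: cI; first by exists t0.
- by exists (interior S) => //; exact: open_interior.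
exists (closure (I `&` interior S)); first exact: closed_closure.
apply/seteqP; split=> [t Bt|b [Ib cb]].
  by split; [case: Bt|exact: subset_closure].
split=> //; rewrite -[interior S b]/(\forall s \near b, jet h 0 s = 0).
have jb k : jet h k b = 0.
  apply: continuous_eq0 (continuous_jet dx dy Ib) _ => P nP.
  have [s [[Is Ss] Ps]] := cb P nP.
  by exists s => //; exact: (jet_near0 oI dx dy Is Ss).
have rb : rate b = 0 by apply: (contact3_curvature_rate reg Ib (member_neq0 Uu)).
have dj q k : \forall s \near b, is_derive s (1 : R) (jet q k) (jet q k.+1 s).
  by apply: filterS (nI Ib) => s; exact: is_derive_jet.
have flat := flat_little_o (dj h) (m := 4) (fun k _ => jb k).
have [c c0 hc] : exists2 c, 0 < c &
    \forall t \near b, c * `|t - b| ^+ 2 <= `|jet (member_rate u) 0 t|.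
  apply: order2_lower_bound (dj _) _ => jr.
  have [m mE] := contact2_proportional reg Ib (member_neq0 Uu) (fun k _ => jb k) jr.
  have := nbhs_singleton nt0; rewrite jet0E => ht0.
  by move: Dt0; rewrite (discriminantE u) mE cf_eval_scale ht0 !mulr0 expr0n subrr eqxx.
pose M := `|jet q2 0 b| + 1.
have M0 : 0 < M by rewrite ltr_wpDl.
have nM : \forall t \near b, `|jet q2 0 t| <= M.
  have /cvgrPdist_le /(_ _ ltr01) := continuous_jet dx dy (h := q2) (k := 0) Ib.
  apply: filterS => t ht; rewrite /M -lerBlDl.
  by apply: le_trans ht; rewrite distrC; exact: lerB_dist.
(* Here rate^2 - 4 q2 h is at least c^2 (t - b)^4 - 4 M o((t - b)^4). *)
have nD : \forall t \near b, t != b -> discriminant (point t) != 0.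
  have e0 : 0 < c ^+ 2 / (8 * M) by rewrite divr_gt0 ?exprn_gt0 // mulr_gt0.
  apply: filterS3 nM hc (flat _ e0) => t h1 h2 h3 tb.
  have d0 : 0 < `|t - b| by rewrite normr_gt0 subr_eq0.
  move: h2 h3; set d := `|t - b| in d0 * => h2 h3.
  rewrite (discriminantE u) -!jet0E gt_eqF // subr_gt0.
  apply: le_lt_trans (ler_norm _) _; rewrite -/h !normrM (ger0_norm (_ : 0 <= 4)) //.
  have d4 : 0 < d ^+ 4 by rewrite exprn_gt0.
  have a1 : 4 * `|jet q2 0 t| * `|jet h 0 t| <= 4 * M * (c ^+ 2 / (8 * M) * d ^+ 4).
    by apply: ler_pM; rewrite ?mulr_ge0 ?ler_wpM2l.
  have e1 : 4 * M * (c ^+ 2 / (8 * M) * d ^+ 4) = (c * d ^+ 2) ^+ 2 / 2.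
    by field; rewrite gt_eqF.
  have a2 : (c * d ^+ 2) ^+ 2 <= jet (member_rate u) 0 t ^+ 2.
    rewrite -[leRHS]real_normK ?num_real // lerXn2r // nnegrE.
    by rewrite mulr_ge0 ?exprn_ge0 ?ltW.
  have a3 : 0 < (c * d ^+ 2) ^+ 2 by rewrite exprn_gt0 // mulr_gt0 ?exprn_gt0.
  by apply: le_lt_trans a1 _; rewrite e1; lra.
have [e /= e0 he] := (nbhs_ballP _ _).1 (filterI nD (nI Ib)).
apply/nbhs_ballP; exists e => //= t bt.
apply: (contact2_arc dx dy reg (A := ball b e) (b := b)) bt => //.
- by move=> s /he[].
- exact: is_interval_ball.
- move=> s /he[Ds Is]; have [->//|sb] := eqVneq s b.
  exact: discriminant_curvature_rate Is (Ds sb).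
- exact: ballxx.
Qed.

Theorem discriminant_or_member :
  (forall t, I t -> discriminant (point t) = 0) \/
  exists2 u, U u & (forall t, I t -> jet (member u) 0 t = 0) /\
    exists2 t, I t & discriminant (point t) != 0.
Proof.
have [D0|nD0] := pselect (forall t, I t -> discriminant (point t) = 0); first by left.
right; have [t [It Dt]] : exists t, I t /\ discriminant (point t) != 0.
  apply: contrapT => h; apply: nD0 => t It.
  by apply/eqP/negPn/negP => Dt; apply: h; exists t.
have [s Ds [Is [u Uu hu]]] := constant_parameter It Dt (near_discriminant It Dt).
exists u => //; split; last by exists t.
exact: arc_extends Uu Is Ds hu.
Qed.

End TangentFamily.

(** * Families touching one of their members *)

Section Pencil.
Variable R : realType.
Implicit Types (x y : nat -> R -> R) (s : circle_form R).

Lemma jet_cf_point x y (t : R) :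
  let p := cf_point (x 0%N t, y 0%N t) in
  [/\ jet x y p 0 t = 0, jet x y p 1 t = 0 & jet x y p 2 t = 2 * speed2 x y t].
Proof. by split; rewrite /jet /speed2 /=; ring. Qed.

(** Adding a multiple of the circle of radius zero at the point of tangency
    turns tangency into contact of order 2. *)
Lemma tangent_pencil x y (I : set R) h h' t :
  (forall t, I t -> (x 1%N t != 0) || (y 1%N t != 0)) -> I t -> h <> cf0 R ->
  (forall k, jet x y h k t = 0) -> jet x y h' 0 t = 0 -> jet x y h' 1 t = 0 ->
  exists k l, forall w, cf_eval h' w =
    k * cf_eval h w + l * cf_eval (cf_point (x 0%N t, y 0%N t)) w.
Proof.
move=> reg It h0 jh j0 j1.
have [p0 p1 p2] := jet_cf_point x y t.
have v0 : speed2 x y t != 0 by rewrite gt_eqF // (speed2_gt0 reg).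
set p := cf_point _ in p0 p1 p2 *.
pose l := jet x y h' 2 t / (2 * speed2 x y t).
have [k kE] : exists k, cf_lin 1 h' (- l) p = cf_scale k h.
  apply: (contact2_proportional reg It h0) => [k _|[|[|[|//]]] _]; first exact: jh.
  - by rewrite jet_lin j0 p0 !mulr0 addr0.
  - by rewrite jet_lin j1 p1 !mulr0 addr0.
  - by rewrite jet_lin p2 /l; field.
exists k, l => w; rewrite -cf_eval_scale -kE cf_eval_lin.
by rewrite mul1r mulNr addrNK.
Qed.

(** Modulo s, three members of the pencil of f and g are multiples of squared
    distances to points of s. Evaluating the linear relation between these
    members at the three points shows that two of the points coincide or one of
    the multiples is zero; so two members, hence f and g, are in the span of s
    and one squared distance. *)
Lemma two_tangency_points s (f g : R * R -> R) (a : 'I_3 -> R)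
    (k l : 'I_3 -> R) (P : 'I_3 -> R * R) : injective a ->
  (forall i, cf_eval s (P i) = 0) ->
  (forall i w, f w + a i * g w =
     k i * cf_eval s w + l i * cf_eval (cf_point (P i)) w) ->
  exists Q k1 l1 k2 l2, forall w,
    f w = k1 * cf_eval s w + l1 * cf_eval (cf_point Q) w /\
    g w = k2 * cf_eval s w + l2 * cf_eval (cf_point Q) w.
Proof.
pose i0 : 'I_3 := ord0; pose i1 : 'I_3 := lift ord0 ord0.
pose i2 : 'I_3 := lift ord0 (lift ord0 ord0).
move=> inja sP hfg.
have n01 : a i0 - a i1 != 0 by rewrite subr_eq0 (inj_eq inja).
have n02 : a i0 - a i2 != 0 by rewrite subr_eq0 (inj_eq inja).
have n12 : a i1 - a i2 != 0 by rewrite subr_eq0 (inj_eq inja).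
(* The members of parameters a i0 and a i1 determine f and g. *)
have solve : forall Q c d, (forall w, l i0 * cf_eval (cf_point (P i0)) w = c * cf_eval (cf_point Q) w) ->
    (forall w, l i1 * cf_eval (cf_point (P i1)) w = d * cf_eval (cf_point Q) w) ->
  exists Q k1 l1 k2 l2, forall w,
    f w = k1 * cf_eval s w + l1 * cf_eval (cf_point Q) w /\
    g w = k2 * cf_eval s w + l2 * cf_eval (cf_point Q) w.
  move=> Q c d hc hd.
  exists Q, ((a i0 * k i1 - a i1 * k i0) / (a i0 - a i1)),
    ((a i0 * d - a i1 * c) / (a i0 - a i1)),
    ((k i0 - k i1) / (a i0 - a i1)), ((c - d) / (a i0 - a i1)) => w.
  have e0 := hfg i0 w; have e1 := hfg i1 w; rewrite hc in e0; rewrite hd in e1.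
  split; apply: (mulIf n01).
    transitivity (a i0 * (f w + a i1 * g w) - a i1 * (f w + a i0 * g w)); first by ring.
    by rewrite e0 e1; field.
  transitivity ((f w + a i0 * g w) - (f w + a i1 * g w)); first by ring.
  by rewrite e0 e1; field.
have [l0|l0] := eqVneq (l i0) 0.
  by apply: (solve (P i1) 0 (l i1)) => w; rewrite ?l0 ?mul0r.
have [l1|l1] := eqVneq (l i1) 0.
  by apply: (solve (P i0) (l i0) 0) => w; rewrite ?l1 ?mul0r.
suff P01 : P i0 = P i1.
  by apply: (solve (P i0) (l i0) (l i1)) => w; rewrite ?P01.
pose D i j := cf_eval (cf_point (P i)) (P j).
have comb j : (a i0 - a i1) * (l i2 * D i2 j) =
    (a i2 - a i1) * (l i0 * D i0 j) + (a i0 - a i2) * (l i1 * D i1 j).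
  have e i : l i * D i j = f (P j) + a i * g (P j).
    by rewrite hfg sP mulr0 add0r.
  by rewrite !e; ring.
have Dii i : D i i = 0 by rewrite /D cf_eval_point !subrr expr0n addr0.
have Dsym i j : D i j = D j i by rewrite /D !cf_eval_point; ring.
have c0 := comb i0; have c1 := comb i1; have c2 := comb i2.
rewrite !Dii !mulr0 ?addr0 ?add0r in c0 c1 c2.
rewrite (Dsym i1 i0) in c0; rewrite (Dsym i0 i2) (Dsym i1 i2) in c2.
have e : 2 * (a i2 - a i1) * (a i0 - a i2) * l i0 * l i1 * D i0 i1 = 0.
  transitivity ((a i2 - a i1) * l i0 * ((a i0 - a i2) * (l i1 * D i0 i1)) +
    (a i0 - a i2) * l i1 * ((a i2 - a i1) * (l i0 * D i0 i1))); first by ring.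
  rewrite -c0 -c1.
  transitivity ((a i0 - a i1) * l i2 * ((a i2 - a i1) * (l i0 * D i2 i0)
    + (a i0 - a i2) * (l i1 * D i2 i1))); first by ring.
  by rewrite -c2 mulr0.
have n21 : a i2 - a i1 != 0 by rewrite -opprB oppr_eq0.
move: e => /eqP; rewrite !mulf_eq0 pnatr_eq0 (negbTE n21) (negbTE n02) (negbTE l0) (negbTE l1) /=.
rewrite /D cf_eval_point => /eqP /sum_sqr_eq0[/eqP + /eqP].
rewrite !subr_eq0 => /eqP e1 /eqP e2.
by move: e1 e2; case: (P i0) (P i1) => ? ? [? ?] /= -> ->.
Qed.

(** Either the quadratic form is the product of two circle forms, between which
    the curve cannot change, or it is definite and vanishes only where the
    squared distance to P does. *)
Lemma binary_form_one_circle x y (I : set R) s (P : R * R) (a b : R) w0 :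
  open I -> is_interval I -> I !=set0 ->
  (forall k t, I t -> is_derive t (1 : R) (x k) (x k.+1 t)) ->
  (forall k t, I t -> is_derive t (1 : R) (y k) (y k.+1 t)) ->
  (forall t, I t -> (x 1%N t != 0) || (y 1%N t != 0)) ->
  cf_eval s w0 = 0 -> cf_eval (cf_point P) w0 != 0 ->
  (forall t, I t -> let w := (x 0%N t, y 0%N t) in
    cf_eval (cf_point P) w ^+ 2 + b * cf_eval (cf_point P) w * cf_eval s w
    + a * cf_eval s w ^+ 2 = 0) ->
  exists2 h, h <> cf0 R & forall t, I t -> jet x y h 0 t = 0.
Proof.
move=> oI itvI I0 dx dy reg s0 p0 q0.
have [d0|d0] := leP 0 (b ^+ 2 - 4 * a); last first.
  exists (cf_point P); first by case=> /eqP; rewrite oner_eq0.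
  move=> t It; rewrite jet0E; have := q0 t It => /=.
  move: (cf_eval (cf_point P) _) (cf_eval s _) => p z pz.
  have z0 : z = 0.
    apply/eqP/negPn/negP => zn.
    have : 0 <= (2 * p + b * z) ^+ 2 by exact: sqr_ge0.
    have -> : (2 * p + b * z) ^+ 2 = (b ^+ 2 - 4 * a) * z ^+ 2 +
      4 * (p ^+ 2 + b * p * z + a * z ^+ 2) by ring.
    by rewrite pz mulr0 addr0 leNgt nmulr_rlt0 // exprn_even_gt0 //= zn.
  move: pz; rewrite z0 !mulr0 expr0n mulr0 !addr0 => /eqP.
  by rewrite sqrf_eq0 => /eqP.
pose r := Num.sqrt (b ^+ 2 - 4 * a).
have rK : r ^+ 2 = b ^+ 2 - 4 * a by rewrite sqr_sqrtr.
have hn c : cf_lin 1 (cf_point P) c s <> cf0 R.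
  move=> e; have := cf_eval_lin 1 (cf_point P) c s w0.
  rewrite e s0 mulr0 addr0 mul1r => e0; move: p0; rewrite -e0.
  by rewrite /cf_eval /= !mul0r !addr0 eqxx.
apply: (two_circles_one_circle oI dx dy reg itvI I0 (hn ((b - r) / 2)) (hn ((b + r) / 2))).
move=> t It; rewrite !jet0E !cf_eval_lin -[RHS](q0 t It) /=.
have -> : a = (b ^+ 2 - r ^+ 2) / 4 by rewrite rK; field.
by field.
Qed.

Variables q0 q1 q2 : circle_form R.
Variables (x y : nat -> R -> R) (I U : set R).
Hypothesis oI : open I.
Hypothesis dx : forall k t, I t -> is_derive t (1 : R) (x k) (x k.+1 t).
Hypothesis dy : forall k t, I t -> is_derive t (1 : R) (y k) (y k.+1 t).
Hypothesis reg : forall t, I t -> (x 1%N t != 0) || (y 1%N t != 0).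

Local Notation jet := (jet x y).
Local Notation member := (member q0 q1 q2).
Local Notation member_rate := (member_rate q1 q2).
Local Notation discriminant := (discriminant q0 q1 q2).

(** All members touch the member s of parameter u0. Modulo s, the member of
    parameter u is (u - u0) (r + (u - u0) q2), where r is the derivative of the
    family at u0. So r + (u - u0) q2 touches s for all u, which puts r and q2 in
    the span of s and one squared distance, and the discriminant is
    r^2 - 4 q2 s. *)
Theorem discriminant_pencil u0 : U u0 -> member u0 <> cf0 R ->
  (exists a : 'I_3 -> R, [/\ injective a, forall i, U (a i) & forall i, a i != u0]) ->
  (forall u, U u -> exists2 t, I t & jet (member u) 0 t = 0 /\ jet (member u) 1 t = 0) ->
  (forall t, I t -> jet (member u0) 0 t = 0) ->
  exists P k1 l1 k2 l2, forall w,
    discriminant w =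
      (k1 * cf_eval (member u0) w + l1 * cf_eval (cf_point P) w) ^+ 2
      - 4 * (k2 * cf_eval (member u0) w + l2 * cf_eval (cf_point P) w)
        * cf_eval (member u0) w.
Proof.
move=> Uu0 h0 [a [inja Ua anu]] touch on0.
have jh t k : I t -> jet (member u0) k t = 0.
  move=> It; apply: (jet_near0 oI dx dy It).
  by apply: filterS (near_domain oI It) => v; exact: on0.
have hyp i : exists klP : R * R * (R * R), cf_eval (member u0) klP.2 = 0 /\
    forall w, cf_eval (member_rate u0) w + (a i - u0) * cf_eval q2 w =
      klP.1.1 * cf_eval (member u0) w + klP.1.2 * cf_eval (cf_point klP.2) w.
  have [t It [j0 j1]] := touch _ (Ua i).
  pose g := cf_lin 1 (member_rate u0) (a i - u0) q2.
  have an : a i - u0 != 0 by rewrite subr_eq0.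
  have jg k : jet (member (a i)) k t = 0 -> jet g k t = 0.
    move=> jm; apply: (mulfI an); rewrite mulr0 -jm -[RHS](subr0) -(jh t k It).
    by rewrite !jet_member !jet_lin; ring.
  have [k [l kl]] := tangent_pencil reg It h0 (fun k => jh t k It) (jg 0%N j0) (jg 1%N j1).
  exists (k, l, (x 0%N t, y 0%N t)) => /=; split; first by rewrite -jet0E on0.
  by move=> w; rewrite -kl /g (cf_eval_lin 1) mul1r.
have [F hF] := choice hyp.
have inja' : injective (fun i => a i - u0) by move=> i j /addIr /inja.
have [P [k1 [l1 [k2 [l2 h]]]]] := two_tangency_points (s := member u0)
  (f := cf_eval (member_rate u0)) (g := cf_eval q2) inja'
  (fun i => (hF i).1) (fun i => (hF i).2).
exists P, k1, l1, k2, l2 => w; have [e1 e2] := h w.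
by rewrite (discriminantE _ _ _ u0) e1 e2.
Qed.

End Pencil.

(** * Cyclics, isotropic circles and isotropic spheres *)

Section Cyclics.
Variable R : realType.
Implicit Type h : circle_form R.

Lemma continuous_cf_eval h : continuous (cf_eval h).
Proof.
move=> w; have c1 : {for w, continuous (fst : R * R -> R)} by apply: cvg_fst.
have c2 : {for w, continuous (snd : R * R -> R)} by apply: cvg_snd.
apply: cvgD; last exact: cvg_cst.
apply: cvgD; last by apply: cvgM; [exact: cvg_cst|exact: c2].
apply: cvgD; last by apply: cvgM; [exact: cvg_cst|exact: c1].
apply: cvgM; first exact: cvg_cst.
by apply: cvgD; apply: cvgM.
Qed.

Lemma cf_eq0_near h (w : R * R) : (\forall p \near w, cf_eval h p = 0) -> h = cf0 R.
Proof.
move=> /nbhs_ballP[e /= e0 he]; pose r := e / 2.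
have r0 : 0 < r by rewrite divr_gt0.
have re : `|r| < e by rewrite gtr0_norm // /r; lra.
have hz (a b : R) : `|a| < e -> `|b| < e -> cf_eval h (w.1 + a, w.2 + b) = 0.
  move=> ha hb; apply: he; split => /=; rewrite /ball /= opprD addrA subrr sub0r normrN //.
have e00 : `|0 : R| < e by rewrite normr0.
have rNe : `|- r| < e by rewrite normrN.
have := hz 0 0 e00 e00; have := hz r 0 re e00; have := hz (- r) 0 rNe e00.
have := hz 0 r e00 re; have := hz 0 (- r) e00 rNe.
rewrite /cf_eval /=; move: h {he hz} => [[[a b] c] d] /=; rewrite !addr0.
case: w => x y /= h1 h2 h3 h4 h0.
have rn : r != 0 by rewrite gt_eqF.
have a0 : a = 0.
  apply: (mulIf (expf_neq0 2 rn)); nra.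
move: h1 h2 h3 h4 h0; rewrite a0 !mul0r !add0r => h1 h2 h3 h4 h0.
have b0 : b = 0 by apply: (mulIf rn); nra.
have c0 : c = 0 by apply: (mulIf rn); nra.
move: h0; rewrite b0 c0 !mul0r !add0r => ->.
by [].
Qed.

Lemma cf_neq0_eval h : h <> cf0 R -> exists w, cf_eval h w != 0.
Proof.
move=> h0; apply: contrapT => no; apply: h0; apply: (@cf_eq0_near h (0, 0)).
apply/nbhs_ballP; exists 1 => //= w _.
by apply/eqP/negPn/negP => hw; apply: no; exists w.
Qed.

Lemma cf_product_neq0 h h' : h <> cf0 R -> h' <> cf0 R ->
  exists w, cf_eval h w * cf_eval h' w != 0.
Proof.
move=> h0 h0'; have [w hw] := cf_neq0_eval h0.
apply: contrapT => no; apply: h0'; apply: (@cf_eq0_near h' w).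
have : \forall p \near w, cf_eval h p != 0.
  exact: cvgr_neq0 (@continuous_cf_eval h w) hw.
apply: filterS => p hp; apply/eqP/negPn/negP => hp'.
by apply: no; exists p; rewrite mulf_neq0.
Qed.

Lemma quadratic_polynomial (e11 e12 e22 l1 l2 k : R) :
  exists Q : {poly {poly R}}, total_degree_le 2 Q /\
  forall x y, Q.[x, y] = e11 * x ^+ 2 + e12 * (x * y) + e22 * y ^+ 2 + l1 * x + l2 * y + k.
Proof.
exists (Poly [:: Poly [:: k; l2; e22]; Poly [:: l1; e12]; Poly [:: e11]]); split.
  move=> i j; rewrite coef_Poly.
  case: i => [|[|[|i]]] /=; rewrite ?nth_nil ?coef0 // !coef_cons coefC if_same.
  - by case: j => [|[|[|j]]].
  - by case: j => [|[|j]].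
  - by case: j.
by move=> x y; rewrite !(horner_Poly, hornerE) /= !(horner_Poly, hornerE) /=; ring.
Qed.

(** The terms of degrees 4 and 3 of a product of circle forms are as in the
    equation of a cyclic. *)
Lemma cyclic_curve_products h1 h2 h3 h4 (k : R) :
  (exists w, cf_eval h1 w * cf_eval h2 w + k * (cf_eval h3 w * cf_eval h4 w) != 0) ->
  cyclic_curve [set w | cf_eval h1 w * cf_eval h2 w
                        + k * (cf_eval h3 w * cf_eval h4 w) = 0].
Proof.
case: h1 h2 h3 h4 => [[[a1 b1] c1] d1] [[[a2 b2] c2] d2] [[[a3 b3] c3] d3]
  [[[a4 b4] c4] d4] [w0 hw0].
pose A := a1 * a2 + k * (a3 * a4).
pose B := a1 * b2 + a2 * b1 + k * (a3 * b4 + a4 * b3).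
pose C := a1 * c2 + a2 * c1 + k * (a3 * c4 + a4 * c3).
pose S := a1 * d2 + a2 * d1 + k * (a3 * d4 + a4 * d3).
have [Q [dQ QE]] := quadratic_polynomial
  (S + b1 * b2 + k * (b3 * b4)) (b1 * c2 + b2 * c1 + k * (b3 * c4 + b4 * c3))
  (S + c1 * c2 + k * (c3 * c4)) (b1 * d2 + b2 * d1 + k * (b3 * d4 + b4 * d3))
  (c1 * d2 + c2 * d1 + k * (c3 * d4 + c4 * d3)) (d1 * d2 + k * (d3 * d4)).
have E w : cf_eval (a1, b1, c1, d1) w * cf_eval (a2, b2, c2, d2) w +
    k * (cf_eval (a3, b3, c3, d3) w * cf_eval (a4, b4, c4, d4) w) =
  A * (w.1 ^+ 2 + w.2 ^+ 2) ^+ 2 + (w.1 ^+ 2 + w.2 ^+ 2) * (B * w.1 + C * w.2) + Q.[w.1, w.2].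
  by rewrite QE /cf_eval /A /B /C /S /=; ring.
exists A, B, C, Q; split=> //.
- move=> [A0 B0 C0 Q0]; move: hw0; rewrite E A0 B0 C0 Q0.
  by rewrite !mul0r !add0r mulr0 !horner0 add0r eqxx.
- by apply/seteqP; split=> w /=; rewrite E.
Qed.

Lemma isotropic_circle_top (C : set (R * R * R)) : isotropic_circle C ->
  (exists2 d, d != 0 & exists o, forall t : R, top_view C (o + t *: d)) \/
  plane_circle (top_view C).
Proof.
case=> [[q [d [k [d0 _ ->]]]] | [_ ?]]; [left|by right].
by exists d => //; exists q.1 => t; exists (q + (t *: d, k * t ^+ 2)) => //; exists t.
Qed.

Lemma isotropic_circle_two_points (C : set (R * R * R)) : isotropic_circle C ->
  exists w w', [/\ top_view C w, top_view C w' & w != w'].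
Proof.
move=> /isotropic_circle_top[[d d0 [q h]] | [c [r r0 ->]]].
  exists (q + 0 *: d), (q + 1 *: d); split=> //.
  by rewrite scale0r scale1r addr0 -subr_eq0 opprD addrA subrr sub0r oppr_eq0.
exists (c.1 + r, c.2), (c.1 - r, c.2); split=> /=; [ring|ring|].
by apply/eqP => -[]; lra.
Qed.

(** Three points of a line and four points of a circle determine the
    coefficients up to a factor. *)
Lemma isotropic_circle_cf (C : set (R * R * R)) : isotropic_circle C ->
  exists hC : circle_form R, forall h, (forall w, top_view C w -> cf_eval h w = 0) ->
    exists m, h = cf_scale m hC.
Proof.
move=> /isotropic_circle_top[[d d0 [q hT]] | [c [r r0 ->]]].
  have nd : d.1 ^+ 2 + d.2 ^+ 2 != 0.
    apply: contra d0 => /eqP /sum_sqr_eq0[].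
    by case: (d) => ? ? /= -> ->.
  exists (0, - d.2, d.1, d.2 * q.1 - d.1 * q.2) => -[[[a b] c] k] hh.
  have e t : cf_eval (a, b, c, k) (q.1 + t * d.1, q.2 + t * d.2) = 0 := hh _ (hT t).
  have := e 0; have := e 1; have := e (-1); rewrite /cf_eval /= => e3 e2 e1.
  have a0 : a = 0.
    apply: (mulIf nd); rewrite mul0r.
    transitivity (((a * ((q.1 + 1 * d.1) ^+ 2 + (q.2 + 1 * d.2) ^+ 2) + b * (q.1 + 1 * d.1) +
     c * (q.2 + 1 * d.2) + k) + (a * ((q.1 + -1 * d.1) ^+ 2 + (q.2 + -1 * d.2) ^+ 2) + b * (q.1 + -1 * d.1) +
     c * (q.2 + -1 * d.2) + k) - 2 * (a * ((q.1 + 0 * d.1) ^+ 2 + (q.2 + 0 * d.2) ^+ 2) + b * (q.1 + 0 * d.1) +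
     c * (q.2 + 0 * d.2) + k)) / 2); first by field.
    by rewrite e1 e2 e3; field.
  move: e1 e2; rewrite a0 !mul0r !mul1r !addr0 !add0r => e1 e2.
  have bc : b * d.1 + c * d.2 = 0 by rewrite -e2 -[RHS]subr0 -e1; ring.
  pose m := (c * d.1 - b * d.2) / (d.1 ^+ 2 + d.2 ^+ 2).
  have bE : b = m * - d.2.
    apply: (mulIf nd); rewrite mulrAC /m divfK //.
    by rewrite -[RHS]addr0 -(mulr0 d.1) -bc; ring.
  have cE : c = m * d.1.
    apply: (mulIf nd); rewrite mulrAC /m divfK //.
    by rewrite -[RHS]addr0 -(mulr0 d.2) -bc; ring.
  exists m; apply: cf_ext => //=; first by rewrite mulr0.
  have -> : k = - (b * q.1 + c * q.2) by apply/eqP; rewrite -addr_eq0 addrC e1.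
  by rewrite bE cE; ring.
have rn : r != 0 by rewrite gt_eqF.
exists (1, - 2 * c.1, - 2 * c.2, c.1 ^+ 2 + c.2 ^+ 2 - r ^+ 2) => -[[[a b] k] l] hh.
have hE s t : s ^+ 2 + t ^+ 2 = r ^+ 2 -> a * r ^+ 2 + (2 * a * c.1 + b) * s +
    (2 * a * c.2 + k) * t + (a * (c.1 ^+ 2 + c.2 ^+ 2) + b * c.1 + k * c.2 + l) = 0.
  move=> st; rewrite -(hh (c.1 + s, c.2 + t)) /=; last by rewrite -st; ring.
  by rewrite -st /cf_eval /=; ring.
have h1 := hE r 0; have h2 := hE (- r) 0; have h3 := hE 0 r; have h4 := hE 0 (- r).
rewrite !sqrrN !expr0n !addr0 in h1 h2; rewrite !sqrrN !expr0n !add0r in h3 h4.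
move: (h1 erefl) (h2 erefl) (h3 erefl) (h4 erefl) => {}h1 {}h2 {}h3 {}h4.
have bE : 2 * a * c.1 + b = 0 by apply: (mulIf rn); lra.
have kE : 2 * a * c.2 + k = 0 by apply: (mulIf rn); lra.
have {}bE : b = - (2 * a * c.1) by apply/eqP; rewrite -addr_eq0 addrC bE.
have {}kE : k = - (2 * a * c.2) by apply/eqP; rewrite -addr_eq0 addrC kE.
exists a; apply: cf_ext => /=; [by rewrite mulr1|by rewrite bE; ring|by rewrite kE; ring|].
move: h1; rewrite bE kE => h1; nra.
Qed.

(** A form without quadratic part gives a vertical plane. Otherwise completing
    squares gives a cylinder, of positive radius because the top view has more
    than one point. *)
Lemma vertical_surface (C : set (R * R * R)) h : isotropic_circle C ->
  h <> cf0 R -> (forall w, top_view C w -> cf_eval h w = 0) ->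
  isotropic_sphere [set p : R * R * R | cf_eval h p.1 = 0] \/
  space_plane [set p : R * R * R | cf_eval h p.1 = 0].
Proof.
move=> /isotropic_circle_two_points[w [w' [Tw Tw' ww']]] h0 hT.
have := hT w Tw; have := hT w' Tw'; move: h h0 {hT} => [[[a b] c] d] h0 hw' hw.
have [a0|an] := eqVneq a 0.
  right; exists b, c, 0, d; split.
    move=> [b0 c0 _]; apply: h0; move: hw; rewrite /cf_eval /= a0 b0 c0.
    by rewrite !mul0r !add0r => ->.
  by apply/seteqP; split=> p /=; rewrite /cf_eval /= a0 !mul0r !add0r !addr0.
left; right; pose c1 := - b / (2 * a); pose c2 := - c / (2 * a).
pose r2 := (b ^+ 2 + c ^+ 2 - 4 * a * d) / (4 * a ^+ 2).
have E p : cf_eval (a, b, c, d) p = a * ((p.1 - c1) ^+ 2 + (p.2 - c2) ^+ 2 - r2).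
  by rewrite /cf_eval /c1 /c2 /r2 /=; field.
have E0 p : cf_eval (a, b, c, d) p = 0 -> (p.1 - c1) ^+ 2 + (p.2 - c2) ^+ 2 = r2.
  by rewrite E => /eqP; rewrite mulf_eq0 (negbTE an) subr_eq0 => /eqP.
have r0 : 0 < r2.
  rewrite lt_def -{2}(E0 w hw) addr_ge0 ?sqr_ge0 // andbT.
  apply/eqP => r20; move: ww'; rewrite r20 in E0.
  have [/eqP + /eqP] := sum_sqr_eq0 (E0 w hw); rewrite !subr_eq0 => /eqP e1 /eqP e2.
  have [/eqP + /eqP] := sum_sqr_eq0 (E0 w' hw'); rewrite !subr_eq0 => /eqP e3 /eqP e4.
  by case: w w' e1 e2 e3 e4 {hw hw' Tw Tw'} => ? ? [? ?] /= -> -> -> ->; rewrite eqxx.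
exists [set p | (p.1 - c1) ^+ 2 + (p.2 - c2) ^+ 2 = r2].
  exists (c1, c2), (Num.sqrt r2); first by rewrite sqrtr_gt0.
  by rewrite sqr_sqrtr // ltW.
apply/seteqP; split=> p /=; first exact: E0.
by rewrite E => ->; rewrite subrr mulr0.
Qed.

End Cyclics.

(** * The top views of the two families of isotropic circles *)

Section TopViews.
Variable R : realType.
Implicit Types (P : {poly {poly R}}) (u v : R) (w : R * R).

Lemma bidegree11_horner P u v : bidegree_le 1 1 P ->
  P.[u, v] = P`_0`_0 + P`_1`_0 * u + P`_0`_1 * v + P`_1`_1 * u * v.
Proof.
move=> [sP sYP].
have sc i : (size (P`_i)%R <= 2)%N by exact: leq_trans (max_size_coefXY _ _) sYP.
rewrite (horner_coef_wide _ sP) !big_ord_recr big_ord0 /= add0r expr0 mulr1 expr1.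
rewrite hornerD hornerM hornerC !(horner_coef_wide _ (sc _)).
by rewrite !big_ord_recr !big_ord0 /= !add0r !expr0 !mulr1 !expr1; ring.
Qed.

Lemma bidegree_swapXY i j P : bidegree_le i j P -> bidegree_le j i (swapXY P).
Proof. by move=> [s1 s2]; split; rewrite ?sizeYE ?swapXYK // -sizeYE. Qed.

Variables P0 P1 P2 P3 Z : {poly {poly R}}.

(** In complex notation the top view is (P1 + i P2) / (P0 - i P3). A point w
    is the image of (u, v) iff the two real equations
      w.1 P0 + w.2 P3 - P1 = 0 and w.2 P0 - w.1 P3 - P2 = 0
    hold; below are the coefficients of u^i v^j in them. *)
Definition eq1 i j w : R := w.1 * P0`_i`_j + w.2 * P3`_i`_j - P1`_i`_j.
Definition eq2 i j w : R := w.2 * P0`_i`_j - w.1 * P3`_i`_j - P2`_i`_j.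

(** A minor of the coefficients of these equations, as a circle form. *)
Definition minor i j k l : circle_form R :=
  (P0`_k`_l * P3`_i`_j - P0`_i`_j * P3`_k`_l,
   P1`_i`_j * P3`_k`_l - P1`_k`_l * P3`_i`_j - P0`_i`_j * P2`_k`_l + P0`_k`_l * P2`_i`_j,
   P1`_k`_l * P0`_i`_j - P1`_i`_j * P0`_k`_l - P3`_i`_j * P2`_k`_l + P3`_k`_l * P2`_i`_j,
   P1`_i`_j * P2`_k`_l - P1`_k`_l * P2`_i`_j).

Lemma minor_eval i j k l w : cf_eval (minor i j k l) w =
  eq1 i j w * eq2 k l w - eq1 k l w * eq2 i j w.
Proof. by rewrite /cf_eval /minor /eq1 /eq2 /=; ring. Qed.

(** The coefficients of the result of eliminating v from the two equations, as
    a polynomial in u. *)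
Definition u_coef0 := minor 0 0 0 1.
Definition u_coef1 := cf_lin 1 (minor 0 0 1 1) 1 (minor 1 0 0 1).
Definition u_coef2 := minor 1 0 1 1.

Definition u_member (u : R) : circle_form R := member u_coef0 u_coef1 u_coef2 u.

Definition u_discriminant : R * R -> R := discriminant u_coef0 u_coef1 u_coef2.

(** The discriminant is the hyperdeterminant of the 2 x 2 x 2 array of
    coefficients of the two bilinear equations: it does not change when u and v
    are interchanged. *)
Lemma u_discriminantE w : u_discriminant w =
  (eq1 0 0 w * eq2 1 1 w - eq1 1 1 w * eq2 0 0 w
   + eq1 1 0 w * eq2 0 1 w - eq1 0 1 w * eq2 1 0 w) ^+ 2
  - 4 * (eq1 0 0 w * eq2 0 1 w - eq1 0 1 w * eq2 0 0 w)
      * (eq1 1 0 w * eq2 1 1 w - eq1 1 1 w * eq2 1 0 w).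
Proof. by rewrite /u_discriminant /discriminant cf_eval_lin !minor_eval; ring. Qed.

Lemma u_member_eval u w : cf_eval (u_member u) w =
  (eq1 0 0 w + u * eq1 1 0 w) * (eq2 0 1 w + u * eq2 1 1 w)
  - (eq1 0 1 w + u * eq1 1 1 w) * (eq2 0 0 w + u * eq2 1 0 w).
Proof. by rewrite /u_member member_eval cf_eval_lin !minor_eval; ring. Qed.

Hypothesis bP : [/\ bidegree_le 1 1 P0, bidegree_le 1 1 P1,
  bidegree_le 1 1 P2 & bidegree_le 1 1 P3].

Local Notation param := (parametrization P0 P1 P2 P3 Z).
Local Notation den := (denominator P0 P3).

Lemma u_member_param u v : den (u, v) != 0 ->
  cf_eval (u_member u) (param (u, v)).1 = 0.
Proof.
move=> d0; rewrite u_member_eval; set w := (param (u, v)).1.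
have [b0 b1 b2 b3] := bP.
have e1 : w.1 * P0.[u, v] + w.2 * P3.[u, v] - P1.[u, v] = 0.
  by rewrite /w /=; move: d0; rewrite /denominator /= => d0; field.
have e2 : w.2 * P0.[u, v] - w.1 * P3.[u, v] - P2.[u, v] = 0.
  by rewrite /w /=; move: d0; rewrite /denominator /= => d0; field.
move: e1 e2; rewrite !bidegree11_horner // => e1 e2.
have {}e1 : eq1 0 0 w + u * eq1 1 0 w = - v * (eq1 0 1 w + u * eq1 1 1 w).
  by apply/eqP; rewrite -subr_eq0; apply/eqP; rewrite -[RHS]e1 /eq1; ring.
have {}e2 : eq2 0 0 w + u * eq2 1 0 w = - v * (eq2 0 1 w + u * eq2 1 1 w).
  by apply/eqP; rewrite -subr_eq0; apply/eqP; rewrite -[RHS]e2 /eq2; ring.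
by rewrite e1 e2; ring.
Qed.

Lemma closed_cylinder (h : circle_form R) :
  closed [set p : R * R * R | cf_eval h p.1 = 0].
Proof.
rewrite [X in closed X](_ : _ = (fun p : R * R * R => cf_eval h p.1) @^-1` [set 0]) //.
apply: closed_comp; last exact: closed_eq.
move=> p _; apply: (@continuous_comp _ _ _ (fst : R * R * R -> R * R) (cf_eval h)).
  by apply: cvg_fst.
exact: continuous_cf_eval.
Qed.

Lemma u_circle_member u p : u_circle P0 P1 P2 P3 Z u p ->
  cf_eval (u_member u) p.1 = 0.
Proof.
move=> hp; rewrite -[_ = 0]/([set p : R * R * R | cf_eval (u_member u) p.1 = 0] p).
rewrite ((closure_id _).1 (@closed_cylinder (u_member u))).
by apply: closure_subset hp => _ [v d0 <-]; exact: u_member_param.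
Qed.

Lemma u_top_view_member u w : top_view (u_circle P0 P1 P2 P3 Z u) w ->
  cf_eval (u_member u) w = 0.
Proof. by move=> [p hp <-]; exact: u_circle_member. Qed.

(** If the form vanishes identically then, for this u, all 2 x 2 minors of the
    coefficients of 1 and v in (P0, P1, P2, P3) vanish, by the Pluecker relation,
    and the top view is one point. *)
Lemma u_member_neq0 u v : den (u, v) != 0 ->
  isotropic_circle (u_circle P0 P1 P2 P3 Z u) -> u_member u <> cf0 R.
Proof.
move=> d0 iso m0.
have [b0 b1 b2 b3] := bP.
suff cst w : top_view (u_circle P0 P1 P2 P3 Z u) w -> w = (param (u, v)).1.
  have [w [w' [/cst -> /cst ->]]] := isotropic_circle_two_points iso.
  by rewrite eqxx.
set w0 := (param (u, v)).1.
pose p := P0`_0`_0 + P0`_1`_0 * u; pose p' := P0`_0`_1 + P0`_1`_1 * u.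
pose c := P1`_0`_0 + P1`_1`_0 * u; pose c' := P1`_0`_1 + P1`_1`_1 * u.
pose d := P2`_0`_0 + P2`_1`_0 * u; pose d' := P2`_0`_1 + P2`_1`_1 * u.
pose r := P3`_0`_0 + P3`_1`_0 * u; pose r' := P3`_0`_1 + P3`_1`_1 * u.
have E0 s : P0.[u, s] = p + s * p' by rewrite bidegree11_horner // /p /p'; ring.
have E1 s : P1.[u, s] = c + s * c' by rewrite bidegree11_horner // /c /c'; ring.
have E2 s : P2.[u, s] = d + s * d' by rewrite bidegree11_horner // /d /d'; ring.
have E3 s : P3.[u, s] = r + s * r' by rewrite bidegree11_horner // /r /r'; ring.
move: m0; rewrite /u_member /member /cf_lin /= => -[m1 m2 m3 m4].
have {}m1 : p' * r - p * r' = 0 by rewrite -[RHS]m1 /p /p' /r /r'; ring.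
have {}m2 : c * r' - c' * r - p * d' + p' * d = 0.
  by rewrite -[RHS]m2 /p /p' /r /r' /c /c' /d /d'; ring.
have {}m3 : c' * p - c * p' - r * d' + r' * d = 0.
  by rewrite -[RHS]m3 /p /p' /r /r' /c /c' /d /d'; ring.
have {}m4 : c * d' - c' * d = 0 by rewrite -[RHS]m4 /c /c' /d /d'; ring.
have sq : (c * p' - c' * p) ^+ 2 + (d * p' - d' * p) ^+ 2 = 0.
  transitivity ((c' * p - c * p') * (c' * p - c * p' - r * d' + r' * d)
     + (d * p' - d' * p) * (c * r' - c' * r - p * d' + p' * d)
     - (p' * r - p * r') * (c * d' - c' * d)); first by ring.
  by rewrite m1 m2 m3; ring.
have [m5 m6] := sum_sqr_eq0 sq.
have m7 : c * r' - c' * r = 0 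
  by rewrite -[RHS](subr0 0) -[X in _ = X - _]m2 -[X in _ = _ - X]m6; ring.
have m8 : r' * d - r * d' = 0 
  by rewrite -[RHS](addr0 0) -[X in _ = X + _]m3 -[X in _ = _ + X]m5; ring.
(* The numerators and denominators at s are proportional to those at v. *)
have cross a a' b b' s : a * b' - a' * b = 0 ->
    (a + v * a') * (b + s * b') = (a + s * a') * (b + v * b').
  move=> ab; apply/eqP; rewrite -subr_eq0; apply/eqP.
  by transitivity ((s - v) * (a * b' - a' * b)); [ring|rewrite ab mulr0].
have n1 : p * c' - p' * c = 0 by rewrite -oppr0 -m5; ring.
have n2 : p * d' - p' * d = 0 by rewrite -oppr0 -m6; ring.
have n3 : p * r' - p' * r = 0 by rewrite -oppr0 -m1; ring.
have n4 : r * c' - r' * c = 0 by rewrite -oppr0 -m7; ring.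
have n5 : r * d' - r' * d = 0 by rewrite -oppr0 -m8; ring.
have wE s : den (u, s) != 0 -> (param (u, s)).1 = w0.
  move: d0; rewrite /w0 /parametrization /denominator /= !E0 !E1 !E2 !E3.
  have := cross _ _ _ _ s n1; have := cross _ _ _ _ s n2; have := cross _ _ _ _ s n3.
  have := cross _ _ _ _ s n4; have := cross _ _ _ _ s n5.
  move: (p + v * p') (p + s * p') (c + v * c') (c + s * c') (d + v * d') (d + s * d')
    (r + v * r') (r + s * r') => a a' k k' l l' q q' x5 x4 x3 x2 x1 dv ds.
  congr (_, _); apply/eqP; rewrite eqr_div //; apply/eqP.
    transitivity (a * a' * (a * k') + (a' * q) * (q * k')
      - (a * l') * (a * q') - q * q' * (q * l')); first by ring.
    by rewrite x1 x2 x4 x5; ring: x3.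
  transitivity ((a * k') * (a * q') + q * q' * (q * k')
      + a * a' * (a * l') + (a' * q) * (q * l')); first by ring.
  by rewrite x1 x2 x4 x5; ring: x3.
(* The singleton of w0 is closed, being a circle of radius 0. *)
have h0 : [set q : R * R * R | cf_eval (cf_point w0) q.1 = 0] `<=` [set q | q.1 = w0].
  move=> q /=; rewrite cf_eval_point => /sum_sqr_eq0[/eqP + /eqP].
  by rewrite !subr_eq0 => /eqP e1 /eqP e2; rewrite [q.1]surjective_pairing e1 e2 -surjective_pairing.
move=> [q hq <-]; apply: (h0 q).
rewrite ((closure_id _).1 (@closed_cylinder (cf_point w0))).
apply: closure_subset hq => _ [s ds <-].
by rewrite /mkset wE // cf_eval_point !subrr expr0n addr0.
Qed.

End TopViews.

Section Interchange.
Variables (R : realType) (P0 P1 P2 P3 Z : {poly {poly R}}).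

Lemma denominator_swapXY u v :
  denominator (swapXY P0) (swapXY P3) (v, u) = denominator P0 P3 (u, v).
Proof. by rewrite /denominator /= !horner2_swapXY. Qed.

Lemma parametrization_swapXY u v :
  parametrization (swapXY P0) (swapXY P1) (swapXY P2) (swapXY P3) (swapXY Z) (v, u) =
  parametrization P0 P1 P2 P3 Z (u, v).
Proof. by rewrite /parametrization denominator_swapXY /= !horner2_swapXY. Qed.

Lemma v_circle_swapXY v : v_circle P0 P1 P2 P3 Z v =
  u_circle (swapXY P0) (swapXY P1) (swapXY P2) (swapXY P3) (swapXY Z) v.
Proof.
rewrite /v_circle /u_circle; congr closure; apply/seteqP; split=> p [u d0 <-];
  exists u; rewrite ?parametrization_swapXY //= ?denominator_swapXY //.
by rewrite -denominator_swapXY.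
Qed.

Lemma v_top_views_swapXY Omega : v_top_views P0 P1 P2 P3 Z Omega =
  u_top_views (swapXY P0) (swapXY P1) (swapXY P2) (swapXY P3) (swapXY Z)
    [set w | Omega (w.2, w.1)].
Proof.
apply/seteqP; split=> T [w Ow <-]; exists (w.2, w.1); rewrite /= ?v_circle_swapXY //.
by case: w Ow.
Qed.

Lemma u_discriminant_swapXY w :
  u_discriminant (swapXY P0) (swapXY P1) (swapXY P2) (swapXY P3) w =
  u_discriminant P0 P1 P2 P3 w.
Proof. by rewrite !u_discriminantE /eq1 /eq2 !coef_swapXY; ring. Qed.

End Interchange.

Section Nondegeneracy.
Variables (R : realType) (P0 P1 P2 P3 Z : {poly {poly R}}).
Hypothesis bP : [/\ bidegree_le 1 1 P0, bidegree_le 1 1 P1,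
  bidegree_le 1 1 P2 & bidegree_le 1 1 P3].

Local Notation param := (parametrization P0 P1 P2 P3 Z).
Local Notation den := (denominator P0 P3).

Lemma continuous_horner2 (P : {poly {poly R}}) (v : R) : bidegree_le 1 1 P ->
  continuous (fun u : R => P.[u, v]).
Proof.
move=> bPP u.
rewrite (_ : (fun u => _) = (fun u => P`_0`_0 + P`_1`_0 * u + P`_0`_1 * v + P`_1`_1 * u * v)).
  have lin (c : R) : {for u, continuous (fun s : R => c * s)}.
    by apply: cvgM; [exact: cvg_cst|exact: cvg_id].
  apply: cvgD; last by apply: cvgM; [exact: lin|exact: cvg_cst].
  apply: cvgD; last exact: cvg_cst.
  by apply: cvgD; [exact: cvg_cst|exact: lin].
by rewrite funeqE => s; rewrite bidegree11_horner.
Qed.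

Lemma continuous_param h (u v : R) : den (u, v) != 0 ->
  {for u, continuous (fun s : R => den (s, v))} /\
  {for u, continuous (fun s : R => cf_eval h (param (s, v)).1)}.
Proof.
move=> d0; have [b0 b1 b2 b3] := bP.
have c0 := @continuous_horner2 _ v b0 u; have c1 := @continuous_horner2 _ v b1 u.
have c2 := @continuous_horner2 _ v b2 u; have c3 := @continuous_horner2 _ v b3 u.
have cd : {for u, continuous (fun s : R => den (s, v))}.
  by apply: cvgD; apply: cvgM.
split=> //.
have ci : {for u, continuous (fun s => (den (s, v))^-1)} by apply: cvgV.
apply: (@continuous_comp _ _ _ (fun s => (param (s, v)).1) (cf_eval h)).
  have cx : {for u, continuous (fun s : R => (param (s, v)).1.1)}.
    by apply: cvgM => //; apply: cvgB; apply: cvgM.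
  have cy : {for u, continuous (fun s : R => (param (s, v)).1.2)}.
    by apply: cvgM => //; apply: cvgD; apply: cvgM.
  exact: (cvg_pair cx cy).
exact: continuous_cf_eval.
Qed.

(** If the discriminant vanishes identically, then the derivative at u0 of the
    family vanishes on the top view {s = 0}, hence is a multiple k s. At the
    image of (u, v0) this gives s (2 + (u - u0) k)^2 = 0, so the top view of the
    circle v = v0 lies on {s = 0}, too. *)
Lemma discriminant_eq0 u0 v0 : den (u0, v0) != 0 ->
  isotropic_circle (u_circle P0 P1 P2 P3 Z u0) ->
  (forall w, u_discriminant P0 P1 P2 P3 w = 0) ->
  exists S, [/\ isotropic_sphere S \/ space_plane S,
    u_circle P0 P1 P2 P3 Z u0 `<=` S & v_circle P0 P1 P2 P3 Z v0 `<=` S].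
Proof.
move=> d0 iso D0.
have s0 := u_member_neq0 bP d0 iso.
set s := u_member P0 P1 P2 P3 u0 in s0.
have sT w : top_view (u_circle P0 P1 P2 P3 Z u0) w -> cf_eval s w = 0.
  exact: u_top_view_member.
set r := member_rate (u_coef1 P0 P1 P2 P3) (u_coef2 P0 P1 P2 P3) u0.
set q2 := u_coef2 P0 P1 P2 P3.
have DE w : cf_eval r w ^+ 2 = 4 * cf_eval q2 w * cf_eval s w.
  by apply/eqP; rewrite -subr_eq0 -[X in _ == X](D0 w) /u_discriminant (discriminantE _ _ _ u0).
have [hC hCP] := isotropic_circle_cf iso.
have [m sE] := hCP s sT.
have [n rE] : exists n, r = cf_scale n hC.
  by apply: hCP => w /sT sw; apply/eqP; rewrite -sqrf_eq0 DE sw mulr0.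
have m0 : m != 0 by apply/eqP => m0; apply: s0; rewrite sE m0 cf_scale0.
pose k := n / m.
have rk w : cf_eval r w = k * cf_eval s w.
  by rewrite rE sE !cf_eval_scale /k mulrA divfK.
exists [set p : R * R * R | cf_eval s p.1 = 0].
split; first exact: vertical_surface iso s0 sT.
  by move=> p; exact: u_circle_member.
(* Over a point off the circle, the equation in u is a perfect square, so at
   most one value of u occurs; by continuity, none does. *)
have off u : den (u, v0) != 0 -> cf_eval s (param (u, v0)).1 != 0 -> 2 + (u - u0) * k = 0.
  move=> du; set w := (param _).1 => sw.
  have e1 : cf_eval (u_member P0 P1 P2 P3 u) w = 0 := u_member_param Z bP du.
  have e2 : cf_eval (u_member P0 P1 P2 P3 u) w = cf_eval s w + (u - u0) * cf_eval r w
      + (u - u0) ^+ 2 * cf_eval q2 w.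
    by rewrite /s /r /q2 /u_member !member_eval !cf_eval_lin; ring.
  have e3 := DE w.
  have q2E : 4 * cf_eval q2 w = k ^+ 2 * cf_eval s w.
    by apply: (mulIf sw); rewrite -e3 rk; ring.
  have : cf_eval s w * (2 + (u - u0) * k) ^+ 2 = 0.
    transitivity (4 * (cf_eval s w + (u - u0) * (k * cf_eval s w)) +
      (u - u0) ^+ 2 * (k ^+ 2 * cf_eval s w)); first by ring.
    by rewrite -q2E -rk -[RHS](mulr0 4) -e1 e2; ring.
  by move=> /eqP; rewrite mulf_eq0 (negbTE sw) sqrf_eq0 => /eqP.
move=> p; rewrite /v_circle => hp.
rewrite ((closure_id _).1 (@closed_cylinder _ s)).
apply: closure_subset hp => _ [u du <-]; rewrite /mkset.
apply/eqP/negPn/negP => su.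
have [cd cs] := continuous_param s du.
have near2 : \forall u' \near u, 2 + (u' - u0) * k = 0.
  have h1 := continuous_neq0 cd du; have h2 := continuous_neq0 cs su.
  by apply: filterS2 h1 h2 => u' h1 h2; exact: off.
have [e /= e0 he] := (nbhs_ballP _ _).1 near2.
have h1 := he u (ballxx u e0).
have h2 : 2 + (u + e / 2 - u0) * k = 0.
  apply: he; rewrite /ball /= opprD addrA subrr sub0r normrN gtr0_norm ?divr_gt0 //; lra.
have k0 : k = 0 by apply: (mulIf (_ : e / 2 != 0)); [rewrite mulf_neq0 ?invr_eq0 ?gt_eqF|lra].
by move: h1; rewrite k0 mulr0 addr0 => /eqP; rewrite pnatr_eq0.
Qed.

End Nondegeneracy.

(** * Coordinates of a regular smooth curve *)

Section SmoothCurves.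
Variable R : realType.

Lemma is_derive_fst (g : R -> R * R) (t : R) v :
  is_derive t (1 : R) g v -> is_derive t (1 : R) (fun s => (g s).1) v.1.
Proof.
case=> dg <-.
have h : (fun h : R => h^-1 *: ((g (h *: 1 + t)).1 - (g t).1)) @ 0^' --> ('D_1 g t).1.
  have := @cvg_comp _ _ _ (fun h : R => h^-1 *: (g (h *: 1 + t) - g t)) fst 0^' _ _ dg.
  by apply; apply: cvg_fst.
by apply: DeriveDef; [exact: cvgP h|exact: cvg_lim h].
Qed.

Lemma is_derive_snd (g : R -> R * R) (t : R) v :
  is_derive t (1 : R) g v -> is_derive t (1 : R) (fun s => (g s).2) v.2.
Proof.
case=> dg <-.
have h : (fun h : R => h^-1 *: ((g (h *: 1 + t)).2 - (g t).2)) @ 0^' --> ('D_1 g t).2.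
  have := @cvg_comp _ _ _ (fun h : R => h^-1 *: (g (h *: 1 + t) - g t)) snd 0^' _ _ dg.
  by apply; apply: cvg_snd.
by apply: DeriveDef; [exact: cvgP h|exact: cvg_lim h].
Qed.

Variables (I : set R) (g : R -> R * R).
Hypothesis rg : regular_smooth_curve I g.

Definition coord1 (k : nat) (t : R) : R := (derive1n k g t).1.
Definition coord2 (k : nat) (t : R) : R := (derive1n k g t).2.

Lemma is_derive_derive1n k t : I t ->
  is_derive t (1 : R) (derive1n k g) (derive1n k.+1 g t).
Proof.
move=> It; have [_ _ _ dg _] := rg.
by rewrite derive1nS derive1E; apply: derivableP; exact: dg.
Qed.

Lemma is_derive_coord1 k t : I t -> is_derive t (1 : R) (coord1 k) (coord1 k.+1 t).
Proof. by move=> It; exact: is_derive_fst (is_derive_derive1n k It). Qed.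

Lemma is_derive_coord2 k t : I t -> is_derive t (1 : R) (coord2 k) (coord2 k.+1 t).
Proof. by move=> It; exact: is_derive_snd (is_derive_derive1n k It). Qed.

Lemma coord_regular t : I t -> (coord1 1 t != 0) || (coord2 1 t != 0).
Proof.
move=> It; have [_ _ _ _ /(_ t It)] := rg; apply: contraR.
rewrite negb_or !negbK /coord1 /coord2 derive1n1 => /andP[/eqP e1 /eqP e2].
by rewrite [derive1 g t]surjective_pairing e1 e2.
Qed.

Lemma jet0_coord h t : jet coord1 coord2 h 0 t = cf_eval h (g t).
Proof. by rewrite jet0E -surjective_pairing. Qed.

Lemma tangent_to_curve_jet T h t : I t ->
  (forall w, T w -> cf_eval h w = 0) -> tangent_to_curve T g t ->
  jet coord1 coord2 h 0 t = 0 /\ jet coord1 coord2 h 1 t = 0.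
Proof.
move=> It hT [Tg [c [c0 Tc dc]]]; split; first by rewrite jet0_coord hT.
have d1 := is_derive_fst dc; have d2 := is_derive_snd dc.
have dq := is_derive_add (is_derive_mul d1 d1) (is_derive_mul d2 d2).
have dl := is_derive_add (is_derive_mulc h.1.1.2 d1) (is_derive_mulc h.1.2 d2).
have := is_derive_add (is_derive_add (is_derive_mulc h.1.1.1 dq) dl)
  (is_derive_cst h.2 (0 : R) (1 : R)).
rewrite (_ : (fun s => _) = (fun _ => 0)); last first.
  rewrite funeqE => s; rewrite -[RHS](hT _ (Tc s)) /cf_eval /cst /=; ring.
move=> /is_derive_unique /(_ (is_derive_cst (0 : R) (0 : R) (1 : R))) <-.
by rewrite /jet /coord1 /coord2 /= c0; ring.
Qed.

End SmoothCurves.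

(** * Envelopes of the top views *)

Section Envelopes.
Variable R : realType.
Implicit Types (g : R -> R * R) (I : set R).

Definition on_circle I g (h : circle_form R) : Prop :=
  h <> cf0 R /\ forall t, I t -> cf_eval h (g t) = 0.

(** The second case is that of an envelope running on the top view {s = 0}: the
    discriminant then vanishes on two circles or lines at most, hence the
    conclusion on other curves, to be applied to envelopes of the other family. *)
Theorem envelope_cases (P0 P1 P2 P3 Z : {poly {poly R}}) (Omega : set (R * R)) I g :
  [/\ bidegree_le 1 1 P0, bidegree_le 1 1 P1, bidegree_le 1 1 P2 &
      bidegree_le 1 1 P3] ->
  open Omega -> (forall w, Omega w -> denominator P0 P3 w != 0) ->
  (forall w, Omega w -> isotropic_circle (u_circle P0 P1 P2 P3 Z w.1)) ->
  regular_smooth_curve I g -> envelope (u_top_views P0 P1 P2 P3 Z Omega) I g ->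
  (forall t, I t -> u_discriminant P0 P1 P2 P3 (g t) = 0) \/
  exists s, on_circle I g s /\ forall J g', regular_smooth_curve J g' ->
    (forall t, J t -> u_discriminant P0 P1 P2 P3 (g' t) = 0) ->
    exists h, on_circle J g' h.
Proof.
move=> bP oO dO cO rg [env1 env2].
pose U := [set u : R | exists v, Omega (u, v)].
have [oI itvI I0 _ _] := rg.
have m0 u : U u -> u_member P0 P1 P2 P3 u <> cf0 R.
  by move=> [v Ouv]; exact: (u_member_neq0 bP (dO _ Ouv) (cO _ Ouv)).
have tan T t u : I t -> T = top_view (u_circle P0 P1 P2 P3 Z u) ->
    tangent_to_curve T g t -> jet (coord1 g) (coord2 g) (u_member P0 P1 P2 P3 u) 0 t = 0 /\
    jet (coord1 g) (coord2 g) (u_member P0 P1 P2 P3 u) 1 t = 0.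
  move=> It -> ht; apply: (tangent_to_curve_jet It _ ht) => w.
  exact: u_top_view_member.
have touch t : I t -> exists2 u, U u &
    jet (coord1 g) (coord2 g) (u_member P0 P1 P2 P3 u) 0 t = 0 /\
    jet (coord1 g) (coord2 g) (u_member P0 P1 P2 P3 u) 1 t = 0.
  move=> It; have [T [w Ow wT] ht] := env2 t It.
  exists w.1; last exact: (tan T).
  by exists w.2; rewrite -surjective_pairing.
have [D0|] := discriminant_or_member oI itvI (is_derive_coord1 rg)
    (is_derive_coord2 rg) (coord_regular rg) m0 touch.
  by left=> t It; have := D0 t It; rewrite -surjective_pairing.
move=> [u Uu [on_u [t0 It0]]]; rewrite -surjective_pairing => Dt0; right.
exists (u_member P0 P1 P2 P3 u).
split; first by split; [exact: m0|move=> t It; rewrite -jet0_coord; exact: on_u].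
have [|u' Uu'|P [k1 [l1 [k2 [l2 DE]]]]] := discriminant_pencil oI (is_derive_coord1 rg)
  (is_derive_coord2 rg) (coord_regular rg) Uu (m0 _ Uu) _ _ on_u.
(* The set of parameters is open, so it contains three more besides u. *)
- have [v Ouv] := Uu.
  have [e /= e0 he] := (nbhs_ballP _ _).1 (open_nbhs_nbhs (conj oO Ouv)).
  have e4 : e / 4 != 0 by rewrite gt_eqF // divr_gt0.
  exists (fun i : 'I_3 => u + e / 4 * i.+1%:R); split.
  + move=> i j /addrI /(mulfI e4) /eqP.
    by rewrite eqr_nat eqSS => /eqP /val_inj.
  + move=> i; exists v; apply: he; split; last exact: ballxx.
    rewrite /ball /= opprD addrA subrr sub0r normrN ger0_norm.
      by rewrite -mulrA gtr_pMr // ltr_pdivrMl // mulr1 ltr_nat ltnS ltn_ord.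
    by rewrite mulr_ge0 // ltW // divr_gt0.
  + move=> i; rewrite -subr_eq0 addrAC subrr add0r.
    by apply: mulf_neq0 => //; rewrite gt_eqF // ltr0Sn.
- have [v Ouv] := Uu'.
  have [t It ht] := env1 _ (ex_intro2 _ _ (u', v) Ouv erefl).
  by exists t => //; exact: (tan _ _ _ It erefl ht).
move=> J g' rg' Dg'; have [oJ itvJ J0 _ _] := rg'.
set s := u_member P0 P1 P2 P3 u.
have st0 : cf_eval s (g t0) = 0 by rewrite -jet0_coord; exact: on_u.
have l1p : l1 * cf_eval (cf_point P) (g t0) != 0.
  apply: contra Dt0 => /eqP lp.
  by rewrite DE st0 lp !mulr0 addr0 expr0n subr0.
have [l1n pn] : l1 != 0 /\ cf_eval (cf_point P) (g t0) != 0.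
  by move: l1p; rewrite mulf_eq0 negb_or => /andP[].
have [|h h0 hJ] := @binary_form_one_circle R _ _ J s P ((k1 ^+ 2 - 4 * k2) / l1 ^+ 2)
   ((2 * k1 * l1 - 4 * l2) / l1 ^+ 2) _ oJ itvJ J0 (is_derive_coord1 rg')
   (is_derive_coord2 rg') (coord_regular rg') st0 pn.
  move=> t Jt; rewrite -surjective_pairing /=.
  apply: (mulfI (expf_neq0 2 l1n)); rewrite mulr0 -(Dg' t Jt) /u_discriminant DE -/s.
  by field.
by exists h; split=> // t Jt; rewrite -jet0_coord; exact: hJ.
Qed.

Lemma two_circles_cyclic I g J g' s h : on_circle I g s -> on_circle J g' h ->
  exists2 K, cyclic_curve K & g @` I `<=` K /\ g' @` J `<=` K.
Proof.
move=> [s0 hs] [h0 hh]; have [w hw] := cf_product_neq0 s0 h0.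
exists [set w | cf_eval s w * cf_eval h w + 0 * (cf_eval s w * cf_eval s w) = 0].
  by apply: cyclic_curve_products; exists w; rewrite mul0r addr0.
by split=> _ [t Jt <-] /=; rewrite ?hs ?hh // ?mul0r ?mulr0 ?mul0r addr0.
Qed.

Lemma discriminant_cyclic (P0 P1 P2 P3 : {poly {poly R}}) w :
  u_discriminant P0 P1 P2 P3 w != 0 ->
  cyclic_curve [set w | u_discriminant P0 P1 P2 P3 w = 0].
Proof.
have E p : u_discriminant P0 P1 P2 P3 p =
    cf_eval (u_coef1 P0 P1 P2 P3) p * cf_eval (u_coef1 P0 P1 P2 P3) p
    + -4 * (cf_eval (u_coef0 P0 P1 P2 P3) p * cf_eval (u_coef2 P0 P1 P2 P3) p).
  by rewrite /u_discriminant /discriminant; ring.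
move=> hw; rewrite (_ : [set w | _] = [set p |
    cf_eval (u_coef1 P0 P1 P2 P3) p * cf_eval (u_coef1 P0 P1 P2 P3) p
    + -4 * (cf_eval (u_coef0 P0 P1 P2 P3) p * cf_eval (u_coef2 P0 P1 P2 P3) p)
    = 0]).
  by apply: cyclic_curve_products; exists w; rewrite -E.
by apply/seteqP; split=> p /=; rewrite E.
Qed.

End Envelopes.

Theorem corollary2 (R : realType)
  (D : set (R * R)) (f : R * R -> R * R * R)
  (alpha beta : R * R * R -> set (R * R * R))
  (P0 P1 P2 P3 Z : {poly {poly R}}) (Omega : set (R * R)) :
  analytic_surface D f ->
  analytic_arcs D f alpha ->
  analytic_arcs D f beta ->
  (forall p, (f @` D) p ->
    [/\ alpha p p, beta p p, alpha p `<=` f @` D, beta p `<=` f @` D &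
        transversal_at (alpha p) (beta p) p]) ->
  (forall p, (f @` D) p -> forall S, isotropic_sphere S \/ space_plane S ->
    ~ (alpha p `<=` S /\ beta p `<=` S)) ->
  (exists E : set (R * R * R),
    [/\ E `<=` f @` D, f @` D `<=` closure E &
        forall p, E p -> finite_set (maximal_arc_in (f @` D) p)]) ->
  [/\ bidegree_le 1 1 P0, bidegree_le 1 1 P1, bidegree_le 1 1 P2,
      bidegree_le 1 1 P3 & bidegree_le 2 2 Z] ->
  P0 ^+ 2 + P3 ^+ 2 != 0 ->
  parametrizes P0 P1 P2 P3 Z Omega D f alpha beta ->
  forall (I1 : set R) (g1 : R -> R * R),
    regular_smooth_curve I1 g1 ->
    envelope (u_top_views P0 P1 P2 P3 Z Omega) I1 g1 ->
    (exists2 K, cyclic_curve K & g1 @` I1 `<=` K) /\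
    forall (I2 : set R) (g2 : R -> R * R),
      regular_smooth_curve I2 g2 ->
      envelope (v_top_views P0 P1 P2 P3 Z Omega) I2 g2 ->
      exists2 K, cyclic_curve K & g1 @` I1 `<=` K /\ g2 @` I2 `<=` K.
Proof.
move=> _ _ _ _ general _ [b0 b1 b2 b3 _] _ [[oO dO] Of _ au bv] I1 g1 rg1 env1.
have [w hw] : exists w, u_discriminant P0 P1 P2 P3 w != 0.
  apply: contrapT => noD.
  have D0 w : u_discriminant P0 P1 P2 P3 w = 0.
    by apply/eqP/negPn/negP => hw; apply: noD; exists w.
  have [_ _ [t It] _ _] := rg1; have [T [[u v] Ow _] _] := env1.2 t It.
  have [S [hS uS vS]] := discriminant_eq0 (And4 b0 b1 b2 b3) (dO _ Ow) (au _ Ow).1 D0.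
  have fp : (f @` D) (parametrization P0 P1 P2 P3 Z (u, v)) by apply: Of; exists (u, v).
  apply: (general _ fp S hS); split.
    exact: subset_trans (au _ Ow).2 uS.
  exact: subset_trans (bv _ Ow).2 vS.
have cK := discriminant_cyclic hw.
have cases1 := envelope_cases (And4 b0 b1 b2 b3) oO dO (fun w Ow => (au w Ow).1) rg1 env1.
split.
  case: cases1 => [D1|[s [s1 _]]].
    by exists [set w | u_discriminant P0 P1 P2 P3 w = 0] => // _ [t It <-]; exact: D1.
  by have [K cyK [K1 _]] := two_circles_cyclic s1 s1; exists K.
move=> I2 g2 rg2 env2; rewrite v_top_views_swapXY in env2.
have bS := And4 (bidegree_swapXY b0) (bidegree_swapXY b1) (bidegree_swapXY b2) (bidegree_swapXY b3).
have := envelope_cases bS _ _ _ rg2 env2.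
have oS : open [set w : R * R | Omega (w.2, w.1)].
  have := @open_comp _ _ (fun w : R * R => (w.2, w.1)) Omega; apply=> // p _.
  by apply: (@cvg_pair _ _ _ _ (nbhs p.2) (nbhs p.1)); [apply: cvg_snd|apply: cvg_fst].
have dS w' : Omega (w'.2, w'.1) -> denominator (swapXY P0) (swapXY P3) w' != 0.
  by case: w' => u v /= /dO; rewrite denominator_swapXY.
have cS w' : Omega (w'.2, w'.1) ->
    isotropic_circle (u_circle (swapXY P0) (swapXY P1) (swapXY P2) (swapXY P3) (swapXY Z) w'.1).
  by move=> Ow; rewrite -v_circle_swapXY; exact: (bv _ Ow).1.
move=> /(_ oS dS cS) cases2.
case: cases1 => [D1|[s [s1 sD]]]; case: cases2 => [D2|[h [h2 hD]]].
- exists [set w | u_discriminant P0 P1 P2 P3 w = 0] => //.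
  split=> _ [t It <-]; first exact: D1.
  by have := D2 t It; rewrite u_discriminant_swapXY.
- have [|h1 on1] := hD I1 g1 rg1.
    by move=> t It; rewrite u_discriminant_swapXY; exact: D1.
  exact: two_circles_cyclic on1 h2.
- have [|h1 on2] := sD I2 g2 rg2.
    by move=> t It; have := D2 t It; rewrite u_discriminant_swapXY.
  exact: two_circles_cyclic s1 on2.
- exact: two_circles_cyclic s1 h2.
Qed.
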